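(* Endow $\mathrm{Ch}(G)$ with the $I$-singular projective model structure. For an object $V_\bullet\in\mathrm{Ch}(G)$ the following are equivalent. (i) $V_\bullet$ is cofibrant. (ii) $V_\bullet$ is an $I$-exact sequence of $I$-projectives, i.e. $V_\bullet$ is termwise $I$-projective and $UV_\bullet=V_\bullet^I$ is an acyclic complex of projective $H$-modules. If these conditions are satisfied then the counit $\varepsilon_{V_\bullet}:FUV_\bullet\to V_\bullet$ is an isomorphism in $\mathrm{Ch}(G)$.
   Context: Let $k$ be a field of characteristic $p>0$ and $G$ a topological group (possibly discrete) admitting an open pro-$p$ subgroup $I$. $\mathrm{Rep}_k^\infty(G)$ is the category of smooth $k$-linear $G$-representations (stabilizers of vectors are open). $\mathbb{X}=\mathrm{ind}_I^G(k)$ is the space of compactly supported $f:G\to k$ with $f(gi)=f(g)$ for $i\in I$, with action $(gf)(g')=f(g^{-1}g')$; $H=\mathrm{End}_G(\mathbb{X})^{\mathrm{op}}$. $\mathrm{Ch}(H)$ and $\mathrm{Ch}(G)$ are the categories of unbounded chain complexes of left $H$-modules and of objects of $\mathrm{Rep}^\infty_k(G)$. $F=\mathbb{X}\otimes_H(\cdot)$ is left adjoint to $U=(\cdot)^I\cong\mathrm{Hom}_G(\mathbb{X},\cdot)$, termwise on complexes, with counit $\varepsilon$. A $G$-representation is $I$-projective if it is a direct summand of $FP$ for some projective $H$-module $P$. A sequence in $\mathrm{Rep}^\infty_k(G)$ is $I$-exact if it is a complex and becomes exact after applying $U$. The singular projective model structure on $\mathrm{Ch}(H)$ is the cofibrantly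 generated abelian model structure (due to Becker) in which: cofibrations are the monomorphisms with acyclic and termwise projective cokernel; fibrations are the epimorphisms; trivial objects are the complexes $Y$ with $\mathrm{Ext}^1_{\mathrm{Ch}(H)}(X,Y)=0$ for all termwise projective acyclic complexes $X$ (weak equivalences are the composites of a monomorphism with projective cokernel in $\mathrm{Ch}(H)$ followed by an epimorphism with trivial kernel). The $I$-singular projective model structure on $\mathrm{Ch}(G)$ is its right transfer along $(F,U)$: $f$ is a fibration (resp. weak equivalence) iff $Uf$ is one in $\mathrm{Ch}(H)$; cofibrations are the maps with the left lifting property with respect to all trivial fibrations. *)

(* Defs.v *)
From HB Require Import structures.
From mathcomp Require Import all_boot all_order all_algebra.
From mathcomp Require Import generic_quotient ring_quotient.
From mathcomp Require Import freeg.
From mathcomp Require Import boolp classical_sets functions cardinality fsbigop.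
From mathcomp Require Import topology.

Set Implicit Arguments.
Unset Strict Implicit.
Unset Printing Implicit Defensive.

Import GRing.Theory.
Local Open Scope classical_set_scope.
Local Open Scope ring_scope.
Local Open Scope card_scope.

HB.mixin Record isTopologicalGroup G & Topological G & Group G := {
  mulg_continuous : continuous (fun x : G * G => (x.1 * x.2)%g);
  invg_continuous : continuous (fun x : G => x^-1%g)
}.

#[short(type="topGroupType")]
HB.structure Definition TopologicalGroup :=
  {G of Topological G & Group G & isTopologicalGroup G}.

Section ProP.
Variable G : topGroupType.

Definition is_subgroup (A : set G) :=
  A 1%g /\ forall x y, A x -> A y -> A (x * y^-1)%g.

Definition lcoset_set (A : set G) (g : G) : set G := [set (g * a)%g | a in A].

Definition normal_in (N A : set G) :=
  [/\ is_subgroup N, N `<=` A &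
      forall a n, A a -> N n -> N (a * n * a^-1)%g].

(* Compact, Hausdorff, totally disconnected, and every open normal subgroup
   has finite p-power index; openness and the Hausdorff property refer to the
   topology induced on A. *)
Definition is_pro_p (p : nat) (A : set G) :=
  [/\ compact A, hausdorff_space (subspace A), totally_disconnected A &
      forall N : set G, normal_in N A -> open (N : set (subspace A)) ->
        exists n, [set lcoset_set N a | a in A] #= `I_(p ^ n)].

Record openProP (p : nat) := OpenProP {
  opp_set :> set G;
  opp_subgroup : is_subgroup opp_set;
  opp_open : open opp_set;
  opp_pro_p : is_pro_p p opp_set
}.

End ProP.

Record smoothRep (k : fieldType) (G : topGroupType) := SmoothRep {
  rep_sort :> lmodType k;
  act : G -> {linear rep_sort -> rep_sort};
  act1 : forall v, act 1%g v = v;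
  actM : forall g h v, act (g * h)%g v = act g (act h v);
  act_smooth : forall v, open [set g | act g v = v]
}.

Arguments act {k G s} g.

Record repHom (k : fieldType) (G : topGroupType) (V W : smoothRep k G) := RepHom {
  hom_lin :> {linear V -> W};
  hom_act : forall g v, hom_lin (act g v) = act g (hom_lin v)
}.

Section TopGroupTheory.
Variable G : topGroupType.

Lemma lmulg_continuous (g : G) : continuous (fun x : G => (g * x)%g).
Proof.
move=> x; apply: (@continuous_comp _ _ _ (fun x => (g, x)) (fun x : G * G => (x.1 * x.2)%g)).
  by apply: cvg_pair => /=; [exact: cvg_cst|exact: cvg_id].
exact: mulg_continuous.
Qed.

Lemma rmulg_continuous (g : G) : continuous (fun x : G => (x * g)%g).
Proof.
move=> x; apply: (@continuous_comp _ _ _ (fun x => (x, g)) (fun x : G * G => (x.1 * x.2)%g)).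
  by apply: cvg_pair => /=; [exact: cvg_id|exact: cvg_cst].
exact: mulg_continuous.
Qed.

Lemma lcoset_set_preim (A : set G) g : lcoset_set A g = (fun x => (g^-1 * x)%g) @^-1` A.
Proof.
apply/seteqP; split=> [x [a Aa <-]|x /= Ax]; first by rewrite /= mulKg.
by exists (g^-1 * x)%g => //; rewrite mulVKg.
Qed.

Lemma open_lcoset (A : set G) g : open A -> open (lcoset_set A g).
Proof.
by rewrite lcoset_set_preim => oA; apply: open_comp => // x _; exact: lmulg_continuous.
Qed.

Lemma subgroup_open (A B : set G) :
  is_subgroup A -> open B -> B 1%g -> B `<=` A -> open A.
Proof.
move=> [A1 AM] oB B1 BA.
have -> : A = \bigcup_(a in A) lcoset_set B a.
  apply/seteqP; split=> [a Aa|x [a Aa [b Bb <-]]].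
    by exists a => //; exists 1%g => //; rewrite mulg1.
  have := AM a (b^-1)%g Aa; rewrite invgK; apply.
  by have := AM 1%g b A1 (BA _ Bb); rewrite mul1g.
by apply: bigcup_open => a _; exact: open_lcoset.
Qed.

Lemma subgroupV (A : set G) x : is_subgroup A -> A x -> A x^-1%g.
Proof. by move=> [A1 AM] Ax; have := AM _ _ A1 Ax; rewrite mul1g. Qed.

Lemma subgroupM (A : set G) x y : is_subgroup A -> A x -> A y -> A (x * y)%g.
Proof. by move=> sA Ax Ay; rewrite -[y]invgK; apply: sA.2 => //; exact: subgroupV. Qed.

Lemma compact_lcosets (I K : set G) : is_subgroup I -> open I -> compact K ->
  exists s : seq G, forall x, K x -> exists2 g, g \in s & lcoset_set I g x.
Proof.
move=> sI oI cK.
pose PG : ptopologicalType := HB.pack (G : Type) (isPointed.Build G 1%g)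
  (Topological.on G).
have : @cover_compact PG K by rewrite -compact_cover.
case/(_ G setT (lcoset_set I)).
- by move=> i _; exact: open_lcoset.
- by move=> x Kx; exists x => //; exists 1%g; rewrite ?mulg1//; exact: sI.1.
move=> D _ cov; exists (finmap.enum_fset D) => x /cov[g /= gD ?]; by exists g.
Qed.

End TopGroupTheory.

Section Induced.
Variables (k : fieldType) (G : topGroupType) (p : nat) (I : openProP G p).

Definition nz_supp (f : G -> k^o) : set G := [set g | f g != 0].

Definition ind_pred (f : G -> k^o) : bool :=
  `[< (forall g i, opp_set I i -> f (g * i)%g = f g) /\ compact (closure (nz_supp f)) >].

Lemma ind_pred_submod : subsemimod_closed ind_pred.
Proof.
have sub_compact (A B : set G) : compact (closure B) -> A `<=` B -> compact (closure A).
  move=> cB AB; apply: (subclosed_compact _ cB); first exact: closed_closure.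
  exact: closure_subset.
split; first split.
- apply/asboolP; split=> //.
  apply: (sub_compact _ set0); first by rewrite closure0; exact: compact0.
  by move=> g; rewrite /nz_supp /= eqxx.
- move=> f g /asboolP[fI cf] /asboolP[gI cg]; apply/asboolP; split.
    by move=> x i Ii; rewrite !fctE fI// gI.
  apply: (sub_compact _ (nz_supp f `|` nz_supp g)).
    by rewrite closureU; exact: compactU.
  move=> x; rewrite /nz_supp /= fctE; have [->|] := eqVneq (f x) 0; last by left.
  by rewrite add0r; right.
- move=> a f /asboolP[fI cf]; apply/asboolP; split.
    by move=> x i Ii; rewrite !fctE fI.
  apply: (sub_compact _ (nz_supp f)) => // x; rewrite /nz_supp /= fctE.
  by apply: contra => /eqP ->; rewrite scaler0.
Qed.

HB.instance Definition _ :=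
  GRing.isSubmodClosed.Build k (G -> k^o) ind_pred ind_pred_submod.

Record indX := IndX { indX_fun :> G -> k^o; _ : ind_pred indX_fun }.
HB.instance Definition _ := [isSub for indX_fun].
HB.instance Definition _ := [Choice of indX by <:].
HB.instance Definition _ := [SubChoice_isSubLmodule of indX by <:].

Local Notation X := indX.

Lemma indX_inv (f : X) g i : opp_set I i -> f (g * i)%g = f g.
Proof. by case: f => f /= /asboolP[fI _]; exact: fI. Qed.

Lemma indX_compact (f : X) : compact (closure (nz_supp f)).
Proof. by case: f => f /= /asboolP[]. Qed.

Lemma indXP (f g : X) : (forall x, f x = g x) -> f = g.
Proof. by move=> fg; apply: val_inj; apply/funext. Qed.

Definition ind_act_fun (g : G) (f : G -> k^o) : G -> k^o := fun x => f (g^-1 * x)%g.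

Lemma ind_act_subproof g (f : X) : ind_pred (ind_act_fun g f).
Proof.
apply/asboolP; split=> [x i Ii|]; first by rewrite /ind_act_fun mulgA indX_inv.
have -> : nz_supp (ind_act_fun g f) = (fun x => (g * x)%g) @` nz_supp f.
  apply/seteqP; split=> [x /= fx|_ [x fx <-]]; last by rewrite /nz_supp /= /ind_act_fun mulKg.
  by exists (g^-1 * x)%g => //; rewrite mulVKg.
pose h x := (g * x)%g.
have ch : compact (h @` closure (nz_supp f)).
  apply: continuous_compact; last exact: indX_compact.
  exact/continuous_subspaceT/lmulg_continuous.
apply: (subclosed_compact _ ch); first exact: closed_closure.
have -> : h @` closure (nz_supp f) = (fun x => (g^-1 * x)%g) @^-1` closure (nz_supp f).
  apply/seteqP; split=> [_ [x cx <-]|x /= cx]; first by rewrite /= mulKg.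
  by exists (g^-1 * x)%g => //; rewrite /h mulVKg.
set K := (K in _ `<=` K).
have <- : closure K = K.
  symmetry; apply/closure_id; apply: closed_comp; last exact: closed_closure.
  by move=> x _; exact: lmulg_continuous.
apply: closure_subset => _ [x fx <-]; rewrite /K /= /h mulKg; exact: subset_closure.
Qed.

Definition ind_act g (f : X) : X := IndX (ind_act_subproof g f).

Lemma ind_act_linear g : linear (ind_act g).
Proof. by move=> a u v; apply: indXP. Qed.
HB.instance Definition _ g := GRing.isLinear.Build k X X _ (ind_act g) (ind_act_linear g).

Lemma ind_act1 f : ind_act 1%g f = f.
Proof. by apply: indXP => x /=; rewrite /ind_act_fun invg1 mul1g. Qed.

Lemma ind_actM g h f : ind_act (g * h)%g f = ind_act g (ind_act h f).
Proof. by apply: indXP => x /=; rewrite /ind_act_fun invgM mulgA. Qed.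

(* The indicator function of I. *)

Definition ind1_fun : G -> k^o := fun g => (`[< opp_set I g >])%:R.

Lemma opp_closed : closed (opp_set I).
Proof.
rewrite -openC.
have -> : ~` opp_set I = \bigcup_(g in ~` opp_set I) lcoset_set (opp_set I) g.
  have [sI oI] := (opp_subgroup I, opp_open I).
  apply/seteqP; split=> [g Ig|_ [g Ig [i Ii <-]] Igi].
    by exists g => //; exists 1%g; rewrite ?mulg1//; exact: sI.1.
  by apply: Ig; rewrite -(mulgK i g); exact: sI.2.
by apply: bigcup_open => g _; apply: open_lcoset; exact: opp_open.
Qed.

Lemma ind1_subproof : ind_pred ind1_fun.
Proof.
have sI := opp_subgroup I.
apply/asboolP; split=> [g i Ii|].
  congr (_%:R); congr (nat_of_bool _); apply: asbool_equiv_eq; split=> Ig.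
    by rewrite -(mulgK i g); exact: sI.2.
  exact: subgroupM.
have -> : nz_supp ind1_fun = opp_set I.
  apply/seteqP; split=> g /=; rewrite /nz_supp /= /ind1_fun.
    by case: asboolP => //; rewrite eqxx.
  by move=> /asboolT ->; rewrite oner_neq0.
have <- : opp_set I = closure (opp_set I) by apply/closure_id; exact: opp_closed.
by have [] := opp_pro_p I.
Qed.
Definition ind1 : X := IndX ind1_subproof.

Lemma nz_supp_finite (f : X) : exists s : seq G,
  forall x, f x != 0 -> exists2 g, g \in s & lcoset_set (opp_set I) g x.
Proof.
have [s sP] := compact_lcosets (opp_subgroup I) (opp_open I) (@indX_compact f).
by exists s => x fx; apply: sP; exact: subset_closure.
Qed.

Lemma ind_act_smooth (f : X) : open [set g | ind_act g f = f].
Proof.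
have [sI oI] := (opp_subgroup I, opp_open I).
have [s sP] := nz_supp_finite f.
pose B := [set h : G | forall g, g \in s -> opp_set I (g^-1 * h * g)%g].
have oB : open B.
  rewrite /B; elim: (s) => [|g t IHt].
    have -> : [set h : G | forall g, g \in [::] -> opp_set I (g^-1 * h * g)%g] = setT.
      by apply/seteqP; split.
    exact: openT.
  have <- : (fun h => (g^-1 * h * g)%g) @^-1` opp_set I `&`
      [set h : G | forall g, g \in t -> opp_set I (g^-1 * h * g)%g] =
      [set h : G | forall g', g' \in g :: t -> opp_set I (g'^-1 * h * g')%g].
    apply/seteqP; split=> [h [Bg Bt] g'|h Bh].
      by rewrite inE => /predU1P[->|]; [|exact: Bt].
    by split=> [|g' g't]; apply: Bh; rewrite inE ?eqxx ?g't ?orbT.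
  apply: openI => //; apply: open_comp => // h _.
  apply: (@continuous_comp _ _ _ (fun h => (g^-1 * h)%g) (fun h => (h * g)%g)).
    exact: lmulg_continuous.
  exact: rmulg_continuous.
apply: (@subgroup_open _ _ B) => //.
- split=> /=; first exact: ind_act1.
  move=> x y fx fy; rewrite ind_actM -[in LHS]fy -ind_actM -ind_actM.
  by rewrite mulgVK.
- by move=> g _; rewrite mulg1 mulVg; exact: sI.1.
have sub h x : B h -> f x != 0 -> f (h^-1 * x)%g = f x.
  move=> Bh /sP[g gs [i Ii <-]].
  have -> : (h^-1 * (g * i))%g = (g * i * (i^-1 * (g^-1 * h * g)^-1 * i))%g.
    by rewrite !invgM invgK !mulgA mulgK mulgV mul1g.
  rewrite (@indX_inv f (g * i)%g)//; apply: (subgroupM sI) => //; apply: (subgroupM sI).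
    exact: (subgroupV sI).
  by apply: (subgroupV sI); exact: Bh.
have Bs : forall h, B h -> B h^-1%g.
  move=> h Bh g gs; have := subgroupV sI (Bh g gs).
  by rewrite !invgM invgK mulgA.
move=> h Bh /=; apply: indXP => x /=; rewrite /ind_act_fun.
have [fx0|] := eqVneq (f x) 0; last exact: sub.
apply: contrapT => /eqP; rewrite fx0 => fn0.
have := sub _ _ (Bs _ Bh) fn0; rewrite invgK mulVKg fx0 => e.
by rewrite -e eqxx in fn0.
Qed.

Definition indRep : smoothRep k G :=
  @SmoothRep k G X (fun g => ind_act g) ind_act1 ind_actM ind_act_smooth.

(* H = End_G(X)^op. *)
Definition hecke_pred (h : X -> X) : bool :=
  `[< linear h /\ forall g f, h (ind_act g f) = ind_act g (h f) >].

Lemma hecke_pred_zmod : zmod_closed hecke_pred.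
Proof.
split=> [|h1 h2 /asboolP[l1 e1] /asboolP[l2 e2]]; apply/asboolP.
  split=> [a u v|g f]; first by change ((0 : X) = a *: 0 + 0); rewrite scaler0 addr0.
  by change ((0 : X) = ind_act g 0); rewrite linear0.
split=> [a u v|g f].
  change (h1 (a *: u + v) - h2 (a *: u + v) = a *: (h1 u - h2 u) + (h1 v - h2 v)).
  by rewrite l1 l2 scalerBr opprD addrACA.
change (h1 (ind_act g f) - h2 (ind_act g f) = ind_act g (h1 f - h2 f)).
by rewrite e1 e2 linearB.
Qed.

HB.instance Definition _ :=
  GRing.isZmodClosed.Build (X -> X) hecke_pred hecke_pred_zmod.

Record hecke := Hecke { hecke_fun :> X -> X; _ : hecke_pred hecke_fun }.
HB.instance Definition _ := [isSub for hecke_fun].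
HB.instance Definition _ := [Choice of hecke by <:].
HB.instance Definition _ := [SubChoice_isSubZmodule of hecke by <:].

Lemma hecke_linear (h : hecke) : linear h.
Proof. by case: h => h /= /asboolP[]. Qed.
HB.instance Definition _ (h : hecke) := GRing.isLinear.Build k X X _ h (hecke_linear h).

Lemma hecke_act (h : hecke) g f : h (ind_act g f) = ind_act g (h f).
Proof. by case: h => h /= /asboolP[_]; exact. Qed.

Lemma heckeP (h1 h2 : hecke) : (forall x, h1 x = h2 x) -> h1 = h2.
Proof. by move=> h12; apply: val_inj; apply/funext. Qed.

Lemma hecke_id_subproof : hecke_pred id.
Proof. by apply/asboolP; split. Qed.
Definition hecke_one : hecke := Hecke hecke_id_subproof.

Lemma hecke_comp_subproof (h1 h2 : hecke) : hecke_pred (h2 \o h1).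
Proof.
apply/asboolP; split=> [a u v|g f] /=; first by rewrite !linearP.
by rewrite !hecke_act.
Qed.
(* Multiplication in the opposite ring: h1 * h2 is "first h1, then h2". *)
Definition hecke_mul (h1 h2 : hecke) : hecke := Hecke (hecke_comp_subproof h1 h2).

Lemma hecke_mulA : associative hecke_mul. Proof. by move=> a b c; apply: heckeP. Qed.
Lemma hecke_mul1r : left_id hecke_one hecke_mul. Proof. by move=> a; apply: heckeP. Qed.
Lemma hecke_mulr1 : right_id hecke_one hecke_mul. Proof. by move=> a; apply: heckeP. Qed.
Lemma hecke_mulDl : left_distributive hecke_mul +%R.
Proof. by move=> a b c; apply: heckeP => x; exact: linearD. Qed.
Lemma hecke_mulDr : right_distributive hecke_mul +%R.
Proof. by move=> a b c; apply: heckeP. Qed.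

HB.instance Definition _ := GRing.Zmodule_isPzRing.Build hecke
  hecke_mulA hecke_mul1r hecke_mulr1 hecke_mulDl hecke_mulDr.

Definition crep (g : G) : G := xget 1%g (lcoset_set (opp_set I) g).

Lemma lcoset_refl g : lcoset_set (opp_set I) g g.
Proof. by exists 1%g; rewrite ?mulg1//; exact: (opp_subgroup I).1. Qed.

Lemma crep_lcoset g : lcoset_set (opp_set I) g (crep g).
Proof. by apply: xgetPex; exists g; exact: lcoset_refl. Qed.

Lemma crep_eq g h : lcoset_set (opp_set I) g h -> crep h = crep g.
Proof.
have sI := opp_subgroup I.
move=> [i Ii <-]; congr xget; apply/seteqP; split=> _ [j Ij <-].
  by exists (i * j)%g; rewrite ?mulgA//; exact: (subgroupM sI).
exists (i^-1 * j)%g; rewrite ?mulgA ?mulgK//.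
by apply: (subgroupM sI) => //; exact: (subgroupV sI).
Qed.

Lemma crepK g : crep (crep g) = crep g.
Proof. exact/crep_eq/crep_lcoset. Qed.

Lemma indX_crep (f : X) g : f (crep g) = f g.
Proof. by have [i Ii <-] := crep_lcoset g; rewrite indX_inv. Qed.

Lemma indX_crepM (f : X) h g : f (h * crep g)%g = f (h * g)%g.
Proof. by have [i Ii <-] := crep_lcoset g; rewrite mulgA (@indX_inv f (h * g)%g). Qed.

Definition creps : set G := [set g | crep g = g].

Definition crep_supp (f : X) (r : seq G) :=
  [/\ uniq r, [set` r] `<=` creps & forall g, creps g -> g \notin r -> f g = 0].

Lemma crep_supp_ex2 (f1 f2 : X) : exists2 r, crep_supp f1 r & crep_supp f2 r.
Proof.
have [s1 s1P] := nz_supp_finite f1; have [s2 s2P] := nz_supp_finite f2.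
pose r := undup (map crep (s1 ++ s2)).
have rP (f : X) (s : seq G) : {subset s <= s1 ++ s2} ->
    (forall x, f x != 0 -> exists2 g, g \in s & lcoset_set (opp_set I) g x) ->
    crep_supp f r.
  move=> ss sP; split; first exact: undup_uniq.
    by move=> g; rewrite /= mem_undup => /mapP[h _ ->]; exact: crepK.
  move=> g gc gr; apply: contraNeq gr => /sP[h hs /crep_eq]; rewrite gc => ->.
  by rewrite mem_undup; apply: map_f; exact: ss.
exists r.
  by apply: (rP _ s1) => // x; rewrite mem_cat => ->.
by apply: (rP _ s2) => // x; rewrite mem_cat orbC => ->.
Qed.

Lemma crep_supp_ex (f : X) : exists r, crep_supp f r.
Proof. by have [r] := crep_supp_ex2 f f; exists r. Qed.

Lemma ind_decomp (f : X) r : crep_supp f r -> f = \sum_(g <- r) f g *: ind_act g ind1.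
Proof.
move=> [ur rc rf]; apply: indXP => x.
have sumE (s : seq G) (F : G -> X) : (\sum_(g <- s) F g) x = \sum_(g <- s) F g x.
  by elim/big_rec2: _ => // g y1 y2 _ <-.
have valE (g : G) : creps g ->
    (f g *: ind_act g ind1 : X) x = if g == crep x then f g else 0.
  move=> gc; rewrite /= /GRing.scale /= /ind_act_fun /ind1_fun.
  case: asboolP => [Ix|nIx].
    have -> : g == crep x.
      rewrite -gc; apply/eqP/esym/crep_eq; exists (g^-1 * x)%g => //.
      by rewrite mulVKg.
    exact: mulr1.
  case: eqP => [gx|_]; last exact: mulr0.
  case: nIx; have [i Ii] := crep_lcoset x; rewrite -gx => <-.
  rewrite invgM -mulgA mulVg mulg1; exact: (subgroupV (opp_subgroup I)).
rewrite sumE (eq_big_seq (fun g => if g == crep x then f g else 0)); last first.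
  by move=> g gr; apply: valE; exact: rc.
rewrite -big_mkcond /=; have [xr|xr] := boolP (crep x \in r).
  rewrite (big_rem (crep x))//= eqxx big_seq_cond big1 ?addr0 ?indX_crep//.
  by move=> g /andP[]; rewrite mem_rem_uniq// inE => /andP[/negbTE ->].
rewrite -indX_crep (rf _ (crepK x) xr) big_seq_cond big1// => g /andP[gr /eqP e].
by rewrite -e gr in xr.
Qed.

Lemma ind1_inv i : opp_set I i -> ind_act i ind1 = ind1.
Proof.
move=> Ii; apply: indXP => x; rewrite /= /ind_act_fun /ind1_fun.
congr (_%:R); congr (nat_of_bool _); apply: asbool_equiv_eq.
have sI := opp_subgroup I; split=> [ix|Ix].
  by rewrite -(mulVKg i x); exact: (subgroupM sI).
by apply: (subgroupM sI) => //; exact: (subgroupV sI).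
Qed.

Section Frobenius.
Variable V : smoothRep k G.

Definition inv_pred (v : V) : bool := `[< forall i, opp_set I i -> act i v = v >].

Lemma inv_pred_zmod : zmod_closed inv_pred.
Proof.
split=> [|u v /asboolP uI /asboolP vI]; apply/asboolP => i Ii; first exact: linear0.
by rewrite linearB/= uI// vI.
Qed.
HB.instance Definition _ := GRing.isZmodClosed.Build V inv_pred inv_pred_zmod.

Record invar := Invar { invar_val : V; _ : inv_pred invar_val }.
HB.instance Definition _ := [isSub for invar_val].
HB.instance Definition _ := [Choice of invar by <:].
HB.instance Definition _ := [SubChoice_isSubZmodule of invar by <:].

Lemma invarP (v : invar) i : opp_set I i -> act i (invar_val v) = invar_val v.
Proof. by case: v => v /= /asboolP; exact. Qed.

(* Frobenius reciprocity V^I = Hom_G(X, V): the unique G-map sending ind1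
   to v; see [frob_unique]. *)
Definition frob (v : invar) (f : X) : V := \sum_(g \in creps) (f g : k) *: act g (invar_val v).

Lemma frobE (v : invar) f r : crep_supp f r ->
  frob v f = \sum_(g <- r) (f g : k) *: act g (invar_val v).
Proof.
move=> [ur rc rf]; rewrite /frob (fsbigE r)//; last first.
  by move=> g gc gr; rewrite rf// scale0r.
rewrite big_seq_cond [RHS]big_seq; apply: eq_bigl => g.
by case: (boolP (g \in r)) => //= /rc gc; rewrite ?andbT mem_set.
Qed.

Lemma frob_linear v : linear (frob v).
Proof.
move=> a f1 f2; have [r s1 s2] := crep_supp_ex2 f1 f2.
have s12 : crep_supp (a *: f1 + f2) r.
  case: s1 s2 => ur rc z1 [_ _ z2]; split=> // g gc gr.
  by change (a *: f1 g + f2 g = 0); rewrite z1// z2// scaler0 addr0.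
rewrite (frobE v s1) (frobE v s2) (frobE v s12) scaler_sumr -big_split/=.
by apply: eq_bigr => g _; rewrite scalerA -scalerDl.
Qed.
HB.instance Definition _ v := GRing.isLinear.Build k X V _ (frob v) (frob_linear v).

Lemma act_crep (v : invar) h g : act (h * crep g)%g (invar_val v) = act (h * g)%g (invar_val v).
Proof.
by have [i Ii <-] := crep_lcoset g; rewrite mulgA [LHS]actM invarP.
Qed.

Lemma frob_act v h f : frob v (ind_act h f) = act h (frob v f).
Proof.
have [r sr] := crep_supp_ex f; rewrite (frobE v sr) linear_sum/=.
have crepM g : creps g -> crep (h^-1 * crep (h * g))%g = g.
  move=> gc; have [i Ii <-] := crep_lcoset (h * g)%g.
  rewrite -[RHS]gc -mulgA mulKg; apply: crep_eq; by exists i.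
have srh : crep_supp (ind_act h f) (map (fun g => crep (h * g)%g) r).
  case: sr => ur rc rf; split.
  - rewrite map_inj_in_uniq// => x y /rc xc /rc yc xy.
    by rewrite -(crepM x)// xy crepM.
  - by move=> g /= /mapP[x _ ->]; exact: crepK.
  - move=> g gc gr; rewrite /= /ind_act_fun -indX_crep.
    apply: rf; first exact: crepK.
    apply: contra gr => cr; apply/mapP; exists (crep (h^-1 * g))%g => //.
    have [i Ii <-] := crep_lcoset (h^-1 * g)%g.
    by rewrite !mulgA mulgV mul1g -[LHS]gc; apply/esym/crep_eq; exists i.
rewrite (frobE v srh) big_map; apply: eq_bigr => g _.
have := act_crep v 1%g (h * g)%g; rewrite !mul1g => ->.
rewrite linearZ/= -actM.
by rewrite /ind_act_fun indX_crepM mulKg.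
Qed.

Lemma frob_ind1 v : frob v ind1 = invar_val v.
Proof.
have i1 : ind1 1%g = 1 by rewrite /= /ind1_fun (asboolT (opp_subgroup I).1).
have s : crep_supp ind1 [:: crep 1%g].
  split=> [//|g /=|g gc]; first by rewrite inE => /eqP ->; exact: crepK.
  rewrite inE => gn; rewrite /= /ind1_fun; case: asboolP => // Ig.
  by case/eqP: gn; rewrite -gc; apply: crep_eq; exists g; rewrite ?mul1g.
rewrite (frobE v s) big_seq1 indX_crep i1 scale1r.
by rewrite -[crep _]mul1g act_crep mulg1 act1.
Qed.

Lemma frob_unique (phi : {linear X -> V}) (v : invar) :
  (forall g f, phi (ind_act g f) = act g (phi f)) -> phi ind1 = invar_val v ->
  forall f, phi f = frob v f.
Proof.
move=> phiG phi1 f; have [r sr] := crep_supp_ex f.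
rewrite (frobE v sr) [in LHS](ind_decomp sr) linear_sum/=.
by apply: eq_bigr => g _; rewrite linearZ/= phiG phi1.
Qed.

Lemma frobD v w f : frob (v + w) f = frob v f + frob w f.
Proof.
have [r sr] := crep_supp_ex f; rewrite !(frobE _ sr) -big_split/=.
by apply: eq_bigr => g _; rewrite linearD scalerDr.
Qed.

(* Left H-module structure on V^I: it is transported from precomposition on
   Hom_G(X, V) through frob. *)
Lemma hecke_scale_subproof (h : hecke) (v : invar) : inv_pred (frob v (h ind1)).
Proof.
by apply/asboolP => i Ii; rewrite -frob_act -hecke_act ind1_inv.
Qed.
Definition hecke_scale (h : hecke) (v : invar) : invar :=
  Invar (hecke_scale_subproof h v).

Lemma frob_hecke (h : hecke) v f : frob (hecke_scale h v) f = frob v (h f).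
Proof.
apply/esym/(@frob_unique (frob v \o h)) => // g x /=.
by rewrite hecke_act frob_act.
Qed.

Lemma hecke_scaleA h1 h2 v : hecke_scale h1 (hecke_scale h2 v) = hecke_scale (h1 * h2) v.
Proof. by apply: val_inj; rewrite /= frob_hecke. Qed.
Lemma hecke_scale1 : left_id 1 hecke_scale.
Proof. by move=> v; apply: val_inj; exact: frob_ind1. Qed.
Lemma hecke_scaleDr : right_distributive hecke_scale +%R.
Proof. by move=> h v w; apply: val_inj; rewrite /= frobD. Qed.
Lemma hecke_scaleDl v : {morph hecke_scale^~ v : h1 h2 / h1 + h2}.
Proof. by move=> h1 h2; apply: val_inj; exact: linearD. Qed.

HB.instance Definition _ := GRing.Zmodule_isLmodule.Build hecke invar
  hecke_scaleA hecke_scale1 hecke_scaleDr hecke_scaleDl.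
End Frobenius.

Section Tensor.
Variable M : lmodType hecke.

Local Notation free := {freeg (X * M)%type / k}.

Inductive tens_rel : free -> Prop :=
| TensRelDl x1 x2 m : tens_rel (<< (x1 + x2, m) >> - << (x1, m) >> - << (x2, m) >>)
| TensRelDr x m1 m2 : tens_rel (<< (x, m1 + m2) >> - << (x, m1) >> - << (x, m2) >>)
| TensRelZ (a : k) x m : tens_rel (<< (a *: x, m) >> - a *: << (x, m) >>)
| TensRelH (h : hecke) x m : tens_rel (<< (h x, m) >> - << (x, h *: m) >>).

(* The k-submodule spanned by tens_rel. *)
Inductive tens_null : free -> Prop :=
| TensNullRel t : tens_rel t -> tens_null t
| TensNull0 : tens_null 0
| TensNullP a t1 t2 : tens_null t1 -> tens_null t2 -> tens_null (a *: t1 + t2).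

Definition tens_null_pred (t : free) : bool := `[< tens_null t >].

Lemma tens_null_zmod : zmod_closed tens_null_pred.
Proof.
split=> [|t1 t2 /asboolP n1 /asboolP n2]; apply/asboolP; first exact: TensNull0.
by rewrite addrC -scaleN1r; exact: TensNullP.
Qed.
HB.instance Definition _ := GRing.isZmodClosed.Build free tens_null_pred tens_null_zmod.

(* The tensor product of X and M over H, where X is a right H-module through x.h = h(x). *)
Definition tensor := Quotient.quot (GRing.ZmodClosed.clone free tens_null_pred _).
HB.instance Definition _ := GRing.Zmodule.on tensor.

Definition tens_pi (t : free) : tensor := (\pi_tensor t)%qT.

Lemma tens_piP (t1 t2 : free) : tens_pi t1 = tens_pi t2 <-> tens_null (t1 - t2).
Proof.
split=> [/eqP|]; first by rewrite -Quotient.idealrBE => /asboolP.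
by move=> n; apply/eqP; rewrite -Quotient.idealrBE; exact/asboolP.
Qed.

Lemma tens_piD t1 t2 : tens_pi (t1 + t2) = tens_pi t1 + tens_pi t2.
Proof. by rewrite /tens_pi Quotient.pi_add. Qed.

Lemma tens_pi_repr (t : tensor) : tens_pi (repr t) = t.
Proof. by rewrite /tens_pi reprK. Qed.

Definition tens_scale (a : k) (t : tensor) : tensor := tens_pi (a *: repr t).

Lemma tens_piZ a t : tens_pi (a *: t) = tens_scale a (tens_pi t).
Proof.
apply/tens_piP; rewrite -scalerBr -[_ *: _]addr0; apply: TensNullP; last exact: TensNull0.
by apply/tens_piP; rewrite tens_pi_repr.
Qed.

Lemma tens_scaleA a b t : tens_scale a (tens_scale b t) = tens_scale (a * b) t.
Proof. by rewrite -(tens_pi_repr t) -!tens_piZ scalerA. Qed.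
Lemma tens_scale1 : left_id 1 tens_scale.
Proof. by move=> t; rewrite -(tens_pi_repr t) -!tens_piZ scale1r. Qed.
Lemma tens_scaleDr : right_distributive tens_scale +%R.
Proof.
move=> a t u; rewrite -(tens_pi_repr t) -(tens_pi_repr u) -tens_piD -!tens_piZ.
by rewrite scalerDr tens_piD.
Qed.
Lemma tens_scaleDl t : {morph tens_scale^~ t : a b / a + b}.
Proof. by move=> a b; rewrite -(tens_pi_repr t) -!tens_piZ scalerDl tens_piD. Qed.
HB.instance Definition _ := GRing.Zmodule_isLmodule.Build k tensor
  tens_scaleA tens_scale1 tens_scaleDr tens_scaleDl.

Lemma tens_pi_scale (a : k) (t : free) : tens_pi (a *: t) = a *: tens_pi t.
Proof. exact: tens_piZ. Qed.

Definition tens (x : X) (m : M) : tensor := tens_pi << (x, m) >>.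

Section Lift.
Variables (W : lmodType k) (b : X -> M -> W).

Definition balanced :=
  [/\ forall x1 x2 m, b (x1 + x2) m = b x1 m + b x2 m,
      forall x m1 m2, b x (m1 + m2) = b x m1 + b x m2,
      forall (a : k) x m, b (a *: x) m = a *: b x m &
      forall (h : hecke) x m, b (h x) m = b x (h *: m)].

Definition free_lift (t : free) : W := fglift (fun xm => b xm.1 xm.2) t.

Lemma free_liftU x m : free_lift << (x, m) >> = b x m.
Proof. by rewrite /free_lift liftU scale1r. Qed.

Lemma free_liftB t1 t2 : free_lift (t1 - t2) = free_lift t1 - free_lift t2.
Proof. exact: lift_is_additive. Qed.

Lemma free_liftD t1 t2 : free_lift (t1 + t2) = free_lift t1 + free_lift t2.
Proof.
have f0 : free_lift 0 = 0 by have := free_liftB 0 0; rewrite !subrr.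
have fN t : free_lift (- t) = - free_lift t by rewrite -sub0r free_liftB f0 sub0r.
by rewrite -[t2]opprK free_liftB !fN opprK.
Qed.

Lemma free_liftZ a t : free_lift (a *: t) = a *: free_lift t.
Proof.
have f0 : free_lift 0 = 0 by have := free_liftB 0 0; rewrite !subrr.
have fsum (s : seq (X * M)) (F : X * M -> free) :
    free_lift (\sum_(i <- s) F i) = \sum_(i <- s) free_lift (F i).
  by elim/big_rec2: _ => // i y1 y2 _ <-; rewrite free_liftD.
rewrite -[t in RHS]freeg_sumE [a *: t]/(fgscale a t) /fgscale !fsum scaler_sumr.
by apply: eq_bigr => i _; rewrite /free_lift !liftU scalerA.
Qed.

Hypothesis bal : balanced.

Lemma free_lift_null t : tens_null t -> free_lift t = 0.
Proof.
case: bal => bDl bDr bZ bH.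
elim=> [_ [x1 x2 m|x m1 m2|a x m|h x m]||a t1 t2 _ IH1 _ IH2].
- by rewrite !free_liftB !free_liftU bDl -addrA -opprD subrr.
- by rewrite !free_liftB !free_liftU bDr -addrA -opprD subrr.
- by rewrite free_liftB free_liftZ !free_liftU bZ subrr.
- by rewrite free_liftB !free_liftU bH subrr.
- by have := free_liftB 0 0; rewrite !subrr.
- by rewrite free_liftD free_liftZ IH1 IH2 scaler0 addr0.
Qed.

Definition tens_lift_fun of balanced := fun t : tensor => free_lift (repr t).
Local Notation tens_lift := (tens_lift_fun bal).

Lemma tens_lift_pi t : tens_lift (tens_pi t) = free_lift t.
Proof.
apply/eqP; rewrite -subr_eq0 /tens_lift_fun -free_liftB; apply/eqP/free_lift_null.
by apply/tens_piP; rewrite tens_pi_repr.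
Qed.

Lemma tens_liftE x m : tens_lift (tens x m) = b x m.
Proof. by rewrite tens_lift_pi free_liftU. Qed.

Lemma tens_lift_linear : linear tens_lift.
Proof.
move=> a t u; rewrite -(tens_pi_repr t) -(tens_pi_repr u).
rewrite -tens_pi_scale -tens_piD !tens_lift_pi.
by rewrite free_liftD free_liftZ.
Qed.
HB.instance Definition _ :=
  GRing.isLinear.Build k tensor W _ tens_lift tens_lift_linear.
End Lift.

Lemma tensDl x1 x2 m : tens (x1 + x2) m = tens x1 m + tens x2 m.
Proof.
rewrite /tens -tens_piD; apply/tens_piP; rewrite opprD addrA.
exact/TensNullRel/TensRelDl.
Qed.
Lemma tensDr x m1 m2 : tens x (m1 + m2) = tens x m1 + tens x m2.
Proof.
rewrite /tens -tens_piD; apply/tens_piP; rewrite opprD addrA.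
exact/TensNullRel/TensRelDr.
Qed.
Lemma tensZ (a : k) x m : tens (a *: x) m = a *: tens x m.
Proof.
rewrite -tens_pi_scale; apply/tens_piP.
exact/TensNullRel/TensRelZ.
Qed.
Lemma tensH (h : hecke) x m : tens (h x) m = tens x (h *: m).
Proof. apply/tens_piP; exact/TensNullRel/TensRelH. Qed.

Lemma tensr0 x : tens x 0 = 0.
Proof. by apply: (addIr (tens x 0)); rewrite -tensDr !add0r. Qed.

Lemma tens_balanced : balanced tens.
Proof. by split; [exact: tensDl|exact: tensDr|exact: tensZ|exact: tensH]. Qed.

Lemma tens_ind (P : tensor -> Prop) : P 0 ->
  (forall a x m t, P t -> P (a *: tens x m + t)) -> forall t, P t.
Proof.
move=> P0 PD t; rewrite -(tens_pi_repr t) -[repr t]freeg_sumE.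
elim: (dom _) => [|[x m] s IHs]; first by rewrite big_nil -(scale0r 0) tens_pi_scale scale0r.
rewrite big_cons tens_piD; set c := coeff _ _.
suff -> : tens_pi << c *g (x, m) >> = c *: tens x m by exact: PD.
rewrite -tens_pi_scale; congr tens_pi.
by apply/eqP/freeg_eqP => y; rewrite coeffZ !coeffU mul1r.
Qed.

Lemma tens_lin_ext (W : lmodType k) (f g : {linear tensor -> W}) :
  (forall x m, f (tens x m) = g (tens x m)) -> forall t, f t = g t.
Proof.
move=> fg; elim/tens_ind => [|a x m t IHt]; first by rewrite !linear0.
by rewrite !linearP fg IHt.
Qed.

Lemma tens_act_balanced g : balanced (fun x m => tens (ind_act g x) m).
Proof.
split=> [x1 x2 m|x m1 m2|a x m|h x m].
- by rewrite linearD tensDl.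
- exact: tensDr.
- by rewrite linearZ tensZ.
- by rewrite -hecke_act tensH.
Qed.
Definition tens_act g : {linear tensor -> tensor} := tens_lift_fun (tens_act_balanced g).

Lemma tens_actE g x m : tens_act g (tens x m) = tens (ind_act g x) m.
Proof. exact: tens_liftE. Qed.

Lemma tens_act1 t : tens_act 1%g t = t.
Proof.
by move: t; apply: (@tens_lin_ext _ (tens_act 1%g) idfun) => x m; rewrite tens_actE ind_act1.
Qed.

Lemma tens_actM g h t : tens_act (g * h)%g t = tens_act g (tens_act h t).
Proof.
move: t; apply: (@tens_lin_ext _ _ (tens_act g \o tens_act h)) => x m /=.
by rewrite !tens_actE ind_actM.
Qed.

Lemma tens_act_smooth t : open [set g | tens_act g t = t].
Proof.
elim/tens_ind: t => [|a x m t IHt].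
  have -> : [set g | tens_act g 0 = 0] = setT by apply/seteqP; split=> // g _ /=; exact: linear0.
  exact: openT.
apply: (@subgroup_open _ _ ([set g | ind_act g x = x] `&` [set g | tens_act g t = t])).
- split=> /=; first exact: tens_act1.
  move=> g h fg fh; rewrite tens_actM -[in LHS]fh -tens_actM -tens_actM.
  by rewrite mulgVK.
- by apply: openI => //; exact: ind_act_smooth.
- by split=> /=; [exact: ind_act1|exact: tens_act1].
- by move=> g /= [gx gt]; rewrite linearP; congr (_ *: _ + _); rewrite ?gt // tens_actE gx.
Qed.

Definition F_obj : smoothRep k G :=
  @SmoothRep k G tensor tens_act tens_act1 tens_actM tens_act_smooth.
End Tensor.

Section Functors.

Section Fmap.
Variables (M N : lmodType hecke) (f : {linear M -> N}).

Lemma F_map_balanced : balanced (fun x m => tens x (f m)).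
Proof.
split=> [x1 x2 m|x m1 m2|a x m|h x m].
- exact: tensDl.
- by rewrite linearD tensDr.
- exact: tensZ.
- by rewrite linearZ tensH.
Qed.

Definition F_lin : {linear tensor M -> tensor N} := tens_lift_fun F_map_balanced.

Lemma F_linE x m : F_lin (tens x m) = tens x (f m).
Proof. exact: tens_liftE. Qed.

Lemma F_lin_act g (t : F_obj M) : F_lin (act g t) = act g (F_lin t : F_obj N).
Proof.
move: t; apply: (@tens_lin_ext _ _ (F_lin \o tens_act M g) (tens_act N g \o F_lin)) => x m /=.
by rewrite tens_actE !F_linE tens_actE.
Qed.

Definition F_map : repHom (F_obj M) (F_obj N) :=
  @RepHom k G (F_obj M) (F_obj N) F_lin F_lin_act.
End Fmap.

Section Umap.
Variables (V W : smoothRep k G) (f : repHom V W).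

Lemma U_map_subproof (v : invar V) : inv_pred (f (invar_val v)).
Proof. by apply/asboolP => i Ii; rewrite -hom_act invarP. Qed.

Definition U_fun (v : invar V) : invar W := Invar (U_map_subproof v).

Lemma frob_nat (v : invar V) x : f (frob v x) = frob (U_fun v) x.
Proof.
move: x; apply: (@frob_unique W (f \o frob v)) => [g x|] /=.
  by rewrite frob_act hom_act.
by rewrite frob_ind1.
Qed.

Lemma U_fun_linear : linear U_fun.
Proof.
by move=> h u v; apply: val_inj; rewrite /= linearD/= frob_nat.
Qed.
HB.instance Definition _ :=
  GRing.isLinear.Build hecke (invar V) (invar W) _ U_fun U_fun_linear.
Definition U_map : {linear invar V -> invar W} := U_fun.
End Umap.

Section Counit.
Variable V : smoothRep k G.

Lemma counit_balanced : balanced (fun x (v : invar V) => frob v x).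
Proof.
split=> [x1 x2 v|x v1 v2|a x v|h x v].
- exact: linearD.
- exact: frobD.
- exact: linearZ.
- by rewrite -frob_hecke.
Qed.

Definition counit_lin : {linear tensor (invar V) -> V} := tens_lift_fun counit_balanced.

Lemma counit_linE x v : counit_lin (tens x v) = frob v x.
Proof. exact: tens_liftE. Qed.

Lemma counit_lin_act g (t : F_obj (invar V)) : counit_lin (act g t) = act g (counit_lin t).
Proof.
move: t.
apply: (@tens_lin_ext _ _ (counit_lin \o tens_act _ g) (act g \o counit_lin)) => x v /=.
by rewrite tens_actE !counit_linE frob_act.
Qed.

Definition counit_rep : repHom (F_obj (invar V)) V :=
  @RepHom k G (F_obj (invar V)) V counit_lin counit_lin_act.
End Counit.

Section Adjunction.
Variables (M : lmodType hecke) (V : smoothRep k G) (g : repHom (F_obj M) V).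

Lemma adj_frob m (v : invar V) : g (tens ind1 m) = invar_val v ->
  forall x, g (tens x m) = frob v x.
Proof.
move=> gv.
have lin : linear (fun x => g (tens x m)).
  by move=> a x1 x2; rewrite tensDl tensZ linearP.
pose L := GRing.isLinear.Build k X V _ (fun x => g (tens x m)) lin.
pose phi : {linear X -> V} := HB.pack (fun x => g (tens x m)) L.
apply: (@frob_unique V phi) => // h x.
change (g (tens (ind_act h x) m) = act h (g (tens x m))).
by rewrite -hom_act /= tens_actE.
Qed.

Lemma adj_subproof m : inv_pred (g (tens ind1 m) : V).
Proof.
apply/asboolP => i Ii; rewrite -hom_act /= tens_actE.
by rewrite ind1_inv.
Qed.

Definition adj_fun m : invar V := Invar (adj_subproof m).

Lemma adj_linear : linear adj_fun.
Proof.
move=> h m1 m2; apply: val_inj => /=; rewrite tensDr linearD/=; congr (_ + _).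
by rewrite -tensH; exact: adj_frob.
Qed.
HB.instance Definition _ :=
  GRing.isLinear.Build hecke M (invar V) _ adj_fun adj_linear.

(* counit_rep exhibits F as left adjoint to U = (.)^I. *)
Lemma F_U_adjunction :
  exists f : {linear M -> invar V},
    (forall t, counit_rep V (F_map f t) = g t) /\
    forall f' : {linear M -> invar V},
      (forall t, counit_rep V (F_map f' t) = g t) -> forall m, f' m = f m.
Proof.
exists adj_fun; split=> [|f' f'g m].
  apply: (@tens_lin_ext _ _ (counit_lin V \o F_lin adj_fun) g) => x m /=.
  by rewrite F_linE counit_linE -(@adj_frob m).
apply: val_inj; rewrite /= -f'g /= F_linE counit_linE.
by rewrite frob_ind1.
Qed.
End Adjunction.
End Functors.
End Induced.

(* Unbounded chain complexes, with d_n : C_{n+1} -> C_n. *)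
Record chMod (R : pzRingType) := ChMod {
  cm_obj :> int -> lmodType R;
  cm_d : forall n : int, {linear cm_obj (n + 1) -> cm_obj n};
  cm_dd : forall n x, cm_d n (cm_d (n + 1) x) = 0
}.

Record chModHom (R : pzRingType) (C D : chMod R) := ChModHom {
  cm_hom :> forall n : int, {linear C n -> D n};
  cm_homd : forall n x, cm_hom n (cm_d C n x) = cm_d D n (cm_hom (n + 1) x)
}.

Record chRep (k : fieldType) (G : topGroupType) := ChRep {
  cr_obj :> int -> smoothRep k G;
  cr_d : forall n : int, repHom (cr_obj (n + 1)) (cr_obj n);
  cr_dd : forall n x, cr_d n (cr_d (n + 1) x) = 0
}.

Record chRepHom (k : fieldType) (G : topGroupType) (V W : chRep k G) := ChRepHom {
  cr_hom :> forall n : int, repHom (V n) (W n);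
  cr_homd : forall n x, cr_hom n (cr_d V n x) = cr_d W n (cr_hom (n + 1) x)
}.

Section ModelModule.
Variable R : pzRingType.

Definition projective_module (P : lmodType R) :=
  forall (M N : lmodType R) (q : {linear M -> N}) (f : {linear P -> N}),
    (forall y, exists x, q x = y) ->
    exists g : {linear P -> M}, forall x, q (g x) = f x.

Definition termwise_projective (C : chMod R) := forall n, projective_module (C n).

Definition acyclic (C : chMod R) :=
  forall n (x : C (n + 1)), cm_d C n x = 0 -> exists y, cm_d C (n + 1) y = x.

Definition ch_mono (A B : chMod R) (f : chModHom A B) := forall n, injective (f n).

Definition ch_epi (A B : chMod R) (f : chModHom A B) :=
  forall n y, exists x, f n x = y.

(* 0 -> A -> B -> C -> 0 is exact: i is a kernel of q, q a cokernel of i. *)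
Definition short_exact (A B C : chMod R) (i : chModHom A B) (q : chModHom B C) :=
  [/\ ch_mono i, ch_epi q & forall n y, q n y = 0 <-> exists x, i n x = y].

(* Vanishing of the Yoneda Ext^1(X, Y) in Ch(R). *)
Definition Ext1_zero (X Y : chMod R) :=
  forall (E : chMod R) (i : chModHom Y E) (q : chModHom E X), short_exact i q ->
    exists s : chModHom X E, forall n x, q n (s n x) = x.

Definition projective_complex (P : chMod R) :=
  forall (A B : chMod R) (q : chModHom A B) (f : chModHom P B), ch_epi q ->
    exists g : chModHom P A, forall n x, q n (g n x) = f n x.

Definition sing_trivial (Y : chMod R) :=
  forall X : chMod R, termwise_projective X -> acyclic X -> Ext1_zero X Y.

Definition sing_fibration (A B : chMod R) (f : chModHom A B) := ch_epi f.

Definition sing_cofibration (A B : chMod R) (f : chModHom A B) :=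
  exists (C : chMod R) (q : chModHom B C),
    [/\ short_exact f q, acyclic C & termwise_projective C].

Definition mono_proj_coker (A B : chMod R) (f : chModHom A B) :=
  exists (C : chMod R) (q : chModHom B C), short_exact f q /\ projective_complex C.

Definition epi_trivial_ker (A B : chMod R) (f : chModHom A B) :=
  exists (K : chMod R) (i : chModHom K A), short_exact i f /\ sing_trivial K.

Definition sing_weq (A B : chMod R) (f : chModHom A B) :=
  exists (E : chMod R) (i : chModHom A E) (q : chModHom E B),
    [/\ forall n x, f n x = q n (i n x), mono_proj_coker i & epi_trivial_ker q].
End ModelModule.

Section Main.
Variables (k : fieldType) (G : topGroupType) (p : nat) (I : openProP G p).
Local Notation H := (hecke k I).

Lemma U_ch_dd (V : chRep k G) n (x : invar I (V (n + 1 + 1))) :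
  U_map I (cr_d V n) (U_map I (cr_d V (n + 1)) x) = 0.
Proof. by apply: val_inj; exact: cr_dd. Qed.

Definition U_ch (V : chRep k G) : chMod H := @ChMod H
  (fun n => invar I (V n)) (fun n => U_map I (cr_d V n)) (@U_ch_dd V).

Lemma U_chmap_d (V W : chRep k G) (f : chRepHom V W) n (x : U_ch V (n + 1)) :
  U_map I (f n) (cm_d (U_ch V) n x) = cm_d (U_ch W) n (U_map I (f (n + 1)) x).
Proof. by apply: val_inj; exact: cr_homd. Qed.

Definition U_chmap (V W : chRep k G) (f : chRepHom V W) : chModHom (U_ch V) (U_ch W) :=
  @ChModHom H (U_ch V) (U_ch W) (fun n => U_map I (f n)) (@U_chmap_d V W f).

Lemma F_ch_dd (C : chMod H) n (x : F_obj (C (n + 1 + 1))) :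
  F_map (cm_d C n) (F_map (cm_d C (n + 1)) x) = 0.
Proof.
move: x; apply: (@tens_lin_ext _ _ _ _ _ _ (F_lin (cm_d C n) \o F_lin (cm_d C (n + 1))) \0)
  => x m /=.
by rewrite !F_linE cm_dd tensr0.
Qed.

Definition F_ch (C : chMod H) : chRep k G := @ChRep k G
  (fun n => F_obj (C n)) (fun n => F_map (cm_d C n)) (@F_ch_dd C).

Lemma counit_d (V : chRep k G) n (x : F_ch (U_ch V) (n + 1)) :
  counit_rep I (V n) (cr_d (F_ch (U_ch V)) n x) =
  cr_d V n (counit_rep I (V (n + 1)) x).
Proof.
move: x; apply: (@tens_lin_ext _ _ _ _ _ _
  (counit_lin I (V n) \o F_lin (U_map I (cr_d V n)))
  (cr_d V n \o counit_lin I (V (n + 1)))) => x v /=.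
by rewrite F_linE !counit_linE -frob_nat.
Qed.

Definition counit (V : chRep k G) : chRepHom (F_ch (U_ch V)) V :=
  @ChRepHom k G (F_ch (U_ch V)) V (fun n => counit_rep I (V n)) (@counit_d V).

Definition ch_iso (V W : chRep k G) (f : chRepHom V W) :=
  exists g : chRepHom W V, forall n, cancel (f n) (g n) /\ cancel (g n) (f n).

Definition I_fibration (V W : chRep k G) (f : chRepHom V W) :=
  sing_fibration (U_chmap f).

Definition I_weq (V W : chRep k G) (f : chRepHom V W) := sing_weq (U_chmap f).

Definition lifts (A B V W : chRep k G) (i : chRepHom A B) (q : chRepHom V W) :=
  forall (u : chRepHom A V) (v : chRepHom B W),
    (forall n x, q n (u n x) = v n (i n x)) ->
    exists h : chRepHom B V,
      (forall n x, h n (i n x) = u n x) /\ (forall n x, q n (h n x) = v n x).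

Definition I_cofibration (A B : chRep k G) (i : chRepHom A B) :=
  forall (V W : chRep k G) (q : chRepHom V W),
    I_fibration q -> I_weq q -> lifts i q.

Lemma zero_rep_smooth (v : 'rV[k]_0) : open [set g : G | idfun v = v].
Proof. by have -> : [set g : G | idfun v = v] = setT; [apply/seteqP; split|exact: openT]. Qed.

Definition zero_rep : smoothRep k G :=
  @SmoothRep k G 'rV[k]_0 (fun=> idfun) (fun=> erefl) (fun _ _ _ => erefl) zero_rep_smooth.

Lemma zero_hom_act (V W : smoothRep k G) g (v : V) :
  (\0 : {linear V -> W}) (act g v) = act g ((\0 : {linear V -> W}) v).
Proof. by rewrite linear0. Qed.

Definition zero_hom (V W : smoothRep k G) : repHom V W := RepHom (@zero_hom_act V W).

Definition zero_ch : chRep k G :=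
  @ChRep k G (fun=> zero_rep) (fun=> zero_hom _ _) (fun _ _ => erefl).

Lemma from_zero_d (V : chRep k G) n (x : zero_ch (n + 1)) :
  zero_hom _ (V n) (cr_d zero_ch n x) = cr_d V n (zero_hom _ (V (n + 1)) x).
Proof. by rewrite [RHS]linear0. Qed.

Definition from_zero (V : chRep k G) : chRepHom zero_ch V :=
  @ChRepHom k G zero_ch V (fun n => zero_hom _ (V n)) (@from_zero_d V).

Definition I_cofibrant (V : chRep k G) := I_cofibration (from_zero V).

Definition direct_summand (V W : smoothRep k G) :=
  exists (V' : smoothRep k G) (i : repHom V W) (j : repHom V' W),
    bijective (fun v : V * V' => i v.1 + j v.2).

Definition I_projective (V : smoothRep k G) :=
  exists P : lmodType H, projective_module P /\ direct_summand V (F_obj P).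

Definition I_exact (V : chRep k G) := acyclic (U_ch V).
End Main.

(* Main.v *)
Require Import Defs.
From HB Require Import structures.
From mathcomp Require Import all_boot all_order all_algebra.
From mathcomp Require Import boolp classical_sets functions fsbigop topology.
From mathcomp Require Import zify.

Set Implicit Arguments.
Unset Strict Implicit.
Unset Printing Implicit Defensive.

Import Order.TTheory GRing.Theory Num.Theory.
Local Open Scope ring_scope.

(* Lifting against trivial fibrations can be tested on explicit maps, so neither the small
   object argument nor cofibrant replacements are needed.

   On a free H-module the unit id -> UF is bijective, since U(X^(S)) = (X^I)^(S) = H^(S); hence
   so is it on projective modules, and the counit is bijective on I-projectives. So a complex V
   as in (ii) is F(UV) with UV cofibrant, and lifting problems for V transpose to Ch(H).

   Let conversely V be cofibrant. Let A_n = F(P_n) with P_n free over UV_n. The disk complexes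
   with terms A_n + A_(n-1) and V_n + V_(n-1) are related by a trivial fibration, and lifting
   V -> Disk(V) against it shows that V_n is a retract of F(P_n). So V = FQ with Q = UV termwise
   projective. Let J = Hom_k(H, k), an injective cogenerator, and let T be a projective
   resolution of J placed in degrees > n. For X acyclic and termwise projective, maps X -> T are
   null-homotopic; so the path fibration of T is a trivial fibration between complexes of
   projectives, hence of the form U(q). A cycle x of Q that is not a boundary is detected by
   some Phi : Q_(n+1) -> J vanishing on boundaries; Phi lifts to a chain map Q -> T, and lifting
   that to the path complex forces Phi x = 0. *)

(** * Modules over a ring *)

Section Modules.
Variable R : pzRingType.

Lemma exists_linear (M N : lmodType R) (F : M -> N) :
  linear F -> exists g : {linear M -> N}, forall x, g x = F x.
Proof.
move=> lF; pose L := GRing.isLinear.Build R M N _ F lF.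
by exists (HB.pack F L : {linear M -> N}).
Qed.

(** Injectivity of [i] makes the chosen preimages unique, hence linear in [x]. *)
Lemma linear_factor_mono (A M N : lmodType R) (i : {linear A -> N}) (g : {linear M -> N}) :
  injective i -> (forall x, exists a, i a = g x) ->
  exists r : {linear M -> A}, forall x, i (r x) = g x.
Proof.
move=> inj /choice[r rP].
have [|r' r'E] := @exists_linear _ _ r; last by exists r' => x; rewrite r'E.
by move=> a x y; apply: inj; rewrite linearP !rP linearP.
Qed.

Lemma linear_factor_epi (M B N : lmodType R) (q : {linear M -> B}) (g : {linear M -> N}) :
  (forall y, exists x, q x = y) -> (forall x, q x = 0 -> g x = 0) ->
  exists r : {linear B -> N}, forall x, r (q x) = g x.
Proof.
move=> /choice[s sP] kg.
have gs x : g (s (q x)) = g x.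
  by apply/eqP; rewrite -subr_eq0 -linearB kg// linearB/= sP subrr.
have [|r rE] := @exists_linear _ _ (g \o s); last by exists r => x; rewrite rE /= gs.
by move=> a x y /=; rewrite -[in LHS](sP x) -[in LHS](sP y) -linearP gs linearP.
Qed.

Section Kernel.
Variables (M N : lmodType R) (f : {linear M -> N}).

Definition ker_pred (x : M) := f x == 0.

Lemma ker_pred_submod : subsemimod_closed ker_pred.
Proof.
split; [split|] => [|x y /eqP fx /eqP fy|a x /eqP fx]; apply/eqP.
- exact: linear0.
- by rewrite linearD /= fx fy addr0.
- by rewrite linearZ /= fx scaler0.
Qed.

HB.instance Definition _ :=
  GRing.isSubmodClosed.Build R M ker_pred ker_pred_submod.

Record kernel := Kernel { kernel_val : M; _ : ker_pred kernel_val }.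
HB.instance Definition _ := [isSub for kernel_val].
HB.instance Definition _ := [Choice of kernel by <:].
HB.instance Definition _ := [SubChoice_isSubLmodule of kernel by <:].

Lemma kernel_val_linear : linear kernel_val. Proof. by []. Qed.
HB.instance Definition _ :=
  GRing.isLinear.Build R kernel M _ kernel_val kernel_val_linear.

Lemma kernelP (x : kernel) : f (kernel_val x) = 0.
Proof. by case: x => x /= /eqP. Qed.

Lemma kernel_ex (x : M) : f x = 0 -> exists y : kernel, kernel_val y = x.
Proof. by move=> /eqP fx; exists (Kernel fx). Qed.
End Kernel.

(** [kernel D] is the pullback of [q] and [f]. It surjects onto [P] because [q] reaches the image of
    [f]; a section followed by the first projection is the lift. *)
Lemma projective_lift (P M N : lmodType R) (q : {linear M -> N}) (f : {linear P -> N}) :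
  projective_module P -> (forall x, exists y, q y = f x) ->
  exists g : {linear P -> M}, forall x, q (g x) = f x.
Proof.
move=> pP qf.
pose D : {linear (M * P)%type -> N} := (q \o fst) \- (f \o snd).
have [y|g gP] := pP (kernel D) P (snd \o @kernel_val _ _ D) idfun.
  have [x qx] := qf y.
  have [|z zE] := @kernel_ex _ _ D (x, y); first by rewrite /= qx subrr.
  by exists z => /=; rewrite zE.
exists (fst \o @kernel_val _ _ D \o g) => x /=.
have := kernelP (g x); rewrite /= => /eqP; rewrite subr_eq0 => /eqP ->.
by rewrite [kernel_val _ in LHS]surjective_pairing; congr (f _); exact: gP.
Qed.
End Modules.

(** * Free modules *)

Section FreeModule.
Variables (R : pzRingType) (S : choiceType).

Definition finite_supp (f : S -> R^o) : bool :=
  `[< exists s : seq S, forall x, x \notin s -> f x = 0 >].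

Lemma finite_supp_submod : subsemimod_closed finite_supp.
Proof.
split; [split|] => [|f g /asboolP[s sP] /asboolP[t tP]|a f /asboolP[s sP]].
- by apply/asboolP; exists [::].
- apply/asboolP; exists (s ++ t) => x; rewrite mem_cat negb_or => /andP[xs xt].
  by rewrite fctE sP// tP// addr0.
- by apply/asboolP; exists s => x xs; rewrite fctE sP// scaler0.
Qed.

HB.instance Definition _ :=
  GRing.isSubmodClosed.Build R (S -> R^o) finite_supp finite_supp_submod.

Record freeMod := FreeMod { freeMod_val :> S -> R^o; _ : finite_supp freeMod_val }.
HB.instance Definition _ := [isSub for freeMod_val].
HB.instance Definition _ := [Choice of freeMod by <:].
HB.instance Definition _ := [SubChoice_isSubLmodule of freeMod by <:].

Lemma freeMod_supp (f : freeMod) : exists2 s : seq S, uniq s & forall x, x \notin s -> f x = 0.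
Proof.
case: f => f /= /asboolP[s sP]; exists (undup s); first exact: undup_uniq.
by move=> x; rewrite mem_undup; exact: sP.
Qed.

Lemma freeModP (f g : freeMod) : (forall x, f x = g x) -> f = g.
Proof. by move=> fg; apply: val_inj; apply/funext. Qed.

Lemma freeModD (f g : freeMod) x : (f + g) x = f x + g x. Proof. by []. Qed.
Lemma freeModZ a (f : freeMod) x : (a *: f) x = a * f x. Proof. by []. Qed.

Lemma freeMod_sum (s : seq S) (F : S -> freeMod) x : (\sum_(y <- s) F y) x = \sum_(y <- s) F y x.
Proof. by elim/big_rec2: _ => // y f g _ <-. Qed.

Definition std_basis_fun (y : S) : S -> R^o := fun x => (x == y)%:R.

Lemma std_basis_subproof y : finite_supp (std_basis_fun y).
Proof. by apply/asboolP; exists [:: y] => x; rewrite inE /std_basis_fun => /negbTE ->. Qed.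

Definition std_basis y : freeMod := FreeMod (std_basis_subproof y).

Lemma freeMod_decomp (f : freeMod) (s : seq S) : uniq s ->
  (forall x, x \notin s -> f x = 0) -> f = \sum_(y <- s) f y *: std_basis y.
Proof.
move=> us sP; apply: freeModP => x; rewrite freeMod_sum.
under eq_bigr do rewrite freeModZ /= /std_basis_fun.
have [xs|xs] := boolP (x \in s).
  rewrite (bigD1_seq x)//= eqxx mulr1 big1 ?addr0// => y.
  by rewrite eq_sym => /negbTE ->; rewrite mulr0.
rewrite sP// big_seq big1// => y ys; case: eqP => [e|_]; last exact: mulr0.
by rewrite e ys in xs.
Qed.

Lemma freeMod_ext (M : lmodType R) (f g : {linear freeMod -> M}) :
  (forall y, f (std_basis y) = g (std_basis y)) -> forall x, f x = g x.
Proof.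
move=> fg x; have [s us sP] := freeMod_supp x.
rewrite (freeMod_decomp us sP) !linear_sum; apply: eq_bigr => y _.
by rewrite !linearZ /= fg.
Qed.

Lemma freeMod_supp2 (f g : freeMod) : exists s : seq S,
  [/\ uniq s, forall x, x \notin s -> f x = 0 & forall x, x \notin s -> g x = 0].
Proof.
have [[s _ sP] [t _ tP]] := (freeMod_supp f, freeMod_supp g).
exists (undup (s ++ t)); split=> [|x|x]; first exact: undup_uniq.
  by rewrite mem_undup mem_cat negb_or => /andP[xs _]; exact: sP.
by rewrite mem_undup mem_cat negb_or => /andP[_ xt]; exact: tP.
Qed.

Lemma freeMod_lift (M : lmodType R) (F : S -> M) :
  exists f : {linear freeMod -> M}, forall y, f (std_basis y) = F y.
Proof.
(* This sum refers to no list; [LE] computes it over any list containing the support, so that [f],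
   [g] and their combination can share one list. *)
pose L (f : freeMod) : M := \sum_(y \in [set: S]) (f y : R) *: F y.
have LE (f : freeMod) (s : seq S) : uniq s -> (forall x, x \notin s -> f x = 0) ->
    L f = \sum_(y <- s) (f y : R) *: F y.
  move=> us sP; rewrite /L (fsbigE s)//; last by move=> y _ ys; rewrite sP// scale0r.
  by rewrite big_seq_cond [RHS]big_seq; apply: eq_bigl => y; rewrite in_setT andbT.
have [|r rE] := @exists_linear _ _ _ L.
  move=> a f g; have [s [us sf sg]] := freeMod_supp2 f g.
  rewrite (LE f s)// (LE g s)// (LE _ s)//; last first.
    by move=> x xs; rewrite freeModD freeModZ sf// sg// mulr0 addr0.
  rewrite scaler_sumr -big_split; apply: eq_bigr => y _.
  by rewrite freeModD freeModZ scalerDl scalerA.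
exists r => y; rewrite rE (LE _ [:: y])//; last first.
  by move=> x; rewrite inE /= /std_basis_fun => /negbTE ->.
by rewrite big_seq1 /= /std_basis_fun eqxx scale1r.
Qed.

Lemma freeMod_projective : projective_module freeMod.
Proof.
move=> M N q f /choice[s sP].
have [g gE] := freeMod_lift (s \o f \o std_basis).
by exists g; apply: (@freeMod_ext _ (q \o g) f) => y /=; rewrite gE /= sP.
Qed.
End FreeModule.

Section FreeCover.
Variables (R : pzRingType) (M : lmodType R).

Definition free_cover : {linear freeMod R M -> M} :=
  sval (cid (freeMod_lift (R := R) (@idfun M))).

Lemma free_cover_surj y : exists x, free_cover x = y.
Proof. by exists (std_basis R y); rewrite /free_cover; case: cid => /= f ->. Qed.
End FreeCover.

(** * An injective cogenerator *)

Section FunctionalExtension.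
Variables (k : fieldType) (V : lmodType k).

Definition linear_rel (E : set (V * k)) :=
  E (0, 0) /\ forall t x y, E x -> E y -> E (t *: x.1 + y.1, t * x.2 + y.2).

Definition functional_rel (E : set (V * k)) := forall a, E (0, a) -> a = 0.

Lemma linear_rel_uniq (E : set (V * k)) x a b :
  linear_rel E -> functional_rel E -> E (x, a) -> E (x, b) -> a = b.
Proof.
move=> [_ lE] fE Ea Eb; have := lE (-1) _ _ Ea Eb.
rewrite /= scaleN1r addNr mulN1r => /fE /eqP.
by rewrite addrC subr_eq0 => /eqP.
Qed.

(** Partial functionals are handled through their graphs. A maximal graph is total, since a vector
    outside its domain could still be sent to 0. *)
Lemma linear_rel_total_extension (E : set (V * k)) : linear_rel E -> functional_rel E ->
  exists A : set (V * k), [/\ linear_rel A, functional_rel A, (E `<=` A)%classic &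
    forall x, exists a, A (x, a)].
Proof.
move=> lE fE.
(* The conditions bear on the union with [E], so that the empty set, which is the union of the empty
   chain, satisfies them too. *)
pose P (A : set (V * k)) := linear_rel (A `|` E)%classic /\ functional_rel (A `|` E)%classic.
have [|A [[lA fA] maxA]] := @Zorn_bigcup _ P.
  move=> F FP totF.
  have [[A0 FA0]|F0] := pselect (exists A, F A); last first.
    have -> : (\bigcup_(X in F) X = set0)%classic.
      by apply/seteqP; split=> // x [X FX]; case: F0; exists X.
    by rewrite /P set0U.
  split; last first.
    by move=> a [[X FX Xa]|Ea]; [apply: (FP _ FX).2; left|exact: fE].
  split; first by right; exact: lE.1.
  have pick x : (\bigcup_(X in F) X `|` E)%classic x -> exists2 X, F X & (X `|` E)%classic x.
    by case=> [[X FX Xx]|Ex]; [exists X => //; left|exists A0 => //; right].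
  move=> t x y /pick[X FX Xx] /pick[Y FY Yy].
  have {X FX Xx Y FY Yy} [Z FZ [Zx Zy]] : exists2 Z, F Z & (Z `|` E)%classic x /\ (Z `|` E)%classic y.
    have [XY|YX] := totF _ _ FX FY.
      by exists Y => //; split=> //; case: Xx => [/XY|]; [left|right].
    by exists X => //; split=> //; case: Yy => [/YX|]; [left|right].
  have [[_ lZ] _] := FP _ FZ.
  by case: (lZ t x y Zx Zy) => [Zxy|]; [left; exists Z|right].
exists (A `|` E)%classic; split=> // x; apply: contrapT => Ax.
pose B : set (V * k) := [set u | exists t v, (A `|` E)%classic v /\ u = (t *: x + v.1, v.2)]%classic.
have AB : ((A `|` E) `<=` B)%classic.
  by move=> [v a] Av; exists 0, (v, a); rewrite scale0r add0r.
have Bx : B (x, 0).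
  by exists 1, (0, 0); split; [exact: lA.1|rewrite /= addr0 scale1r].
have EB : (E `<=` B)%classic by move=> v Ev; apply: AB; right.
apply: (maxA B).
  split=> [v Av|BA]; first by apply: AB; left.
  by apply: Ax; exists 0; left; exact: BA.
rewrite /P (_ : (B `|` E)%classic = B); last exact/setUidPl.
split.
  split; first by apply: EB; exact: lE.1.
  move=> t _ _ [s1 [v1 [Av1 ->]]] [s2 [v2 [Av2 ->]]].
  exists (t * s1 + s2), (t *: v1.1 + v2.1, t * v1.2 + v2.2); split; first exact: lA.2.
  by rewrite /= scalerDr scalerDl scalerA addrACA.
move=> a [t [[v b] /= [Av [tv ->]]]].
have [t0|t0] := eqVneq t 0.
  by move: tv; rewrite t0 scale0r add0r => v0; apply: fA; rewrite v0.
(* For nonzero [t], [x] is [- t^-1 *: v] and would already have the value [- t^-1 * b]; the added 0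
   comes from the pair [(0, 0)] in the linearity condition. *)
case: Ax; exists (- t^-1 * b + 0); have := lA.2 (- t^-1) _ _ Av lA.1.
rewrite /= addr0; congr ((A `|` E)%classic (_, _)).
have -> : v = - (t *: x) by apply/eqP; rewrite -addr_eq0 addrC -tv.
by rewrite scalerN scaleNr opprK scalerA mulVf// scale1r.
Qed.

Lemma functional_extension (E : set (V * k)) : linear_rel E -> functional_rel E ->
  exists g : {linear V -> k^o}, forall x, E x -> g x.1 = x.2.
Proof.
move=> lE fE; have [A [lA fA EA /choice[g gA]]] := linear_rel_total_extension lE fE.
have uA := linear_rel_uniq lA fA.
have [|r rE] := @exists_linear _ V k^o g; last first.
  by exists r => -[x a] /EA Ax; rewrite rE; exact: uA Ax.
move=> a x y; apply: uA (gA _) _.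
exact: (lA.2 a _ _ (gA x) (gA y)).
Qed.
End FunctionalExtension.

Section Injective.
Variable R : pzRingType.

(** The inclusion of kernels expresses extension from the image of [d] without forming that
    image. *)
Definition injective_module (J : lmodType R) :=
  forall (M N : lmodType R) (d : {linear M -> N}) (f : {linear M -> J}),
    (forall x, d x = 0 -> f x = 0) -> exists g : {linear N -> J}, forall x, g (d x) = f x.
End Injective.

Section Coinduced.
Variables (k : fieldType) (R : pzRingType) (c : {rmorphism k -> R}).

Definition restriction (M : lmodType R) : Type := M.

Section Restriction.
Variable M : lmodType R.
HB.instance Definition _ := GRing.Zmodule.on (restriction M).
Definition res_scale (a : k) (x : restriction M) : restriction M := c a *: (x : M).
Lemma res_scaleA a b x : res_scale a (res_scale b x) = res_scale (a * b) x.
Proof. by rewrite /res_scale scalerA rmorphM. Qed.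
Lemma res_scale1 : left_id 1 res_scale.
Proof. by move=> x; rewrite /res_scale rmorph1 scale1r. Qed.
Lemma res_scaleDr : right_distributive res_scale +%R.
Proof. by move=> a x y; exact: scalerDr. Qed.
Lemma res_scaleDl x : {morph res_scale^~ x : a b / a + b}.
Proof. by move=> a b; rewrite /res_scale rmorphD scalerDl. Qed.
HB.instance Definition _ := GRing.Zmodule_isLmodule.Build k (restriction M)
  res_scaleA res_scale1 res_scaleDr res_scaleDl.
End Restriction.

(* The injective cogenerator Hom_k(R, k). *)
Definition dual_pred (f : R -> k) : bool :=
  `[< forall a x y, f (c a * x + y) = a * f x + f y >].

Lemma dual_pred_zmod : zmod_closed dual_pred.
Proof.
split=> [|f g /asboolP lf /asboolP lg]; apply/asboolP => a x y.
  by rewrite mulr0 addr0.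
by rewrite !fctE lf lg mulrBr opprD addrACA.
Qed.
HB.instance Definition _ := GRing.isZmodClosed.Build (R -> k) dual_pred dual_pred_zmod.

Record dual := Dual { dual_val :> R -> k; _ : dual_pred dual_val }.
HB.instance Definition _ := [isSub for dual_val].
HB.instance Definition _ := [Choice of dual by <:].
HB.instance Definition _ := [SubChoice_isSubZmodule of dual by <:].

Lemma dualP (f g : dual) : (forall x, f x = g x) -> f = g.
Proof. by move=> fg; apply: val_inj; apply/funext. Qed.

Lemma dual_lin (f : dual) a x y : f (c a * x + y) = a * f x + f y.
Proof. by case: f => f /= /asboolP. Qed.

Lemma dual_scale_subproof (r : R) (f : dual) : dual_pred (fun x => f (x * r)).
Proof. by apply/asboolP => a x y; rewrite mulrDl -mulrA dual_lin. Qed.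
Definition dual_scale r f := Dual (dual_scale_subproof r f).

Lemma dual_scaleA r s f : dual_scale r (dual_scale s f) = dual_scale (r * s) f.
Proof. by apply: dualP => x /=; rewrite mulrA. Qed.
Lemma dual_scale1 : left_id 1 dual_scale.
Proof. by move=> f; apply: dualP => x /=; rewrite mulr1. Qed.
Lemma dual_scaleDr : right_distributive dual_scale +%R.
Proof. by move=> r f g; apply: dualP. Qed.
Lemma dual_scaleDl f : {morph dual_scale^~ f : r s / r + s}.
Proof.
move=> r s; apply: dualP => x; change (f (x * (r + s)) = f (x * r) + f (x * s)).
by have := dual_lin f 1 (x * r) (x * s); rewrite rmorph1 !mul1r -mulrDr.
Qed.
HB.instance Definition _ := GRing.Zmodule_isLmodule.Build R dual
  dual_scaleA dual_scale1 dual_scaleDr dual_scaleDl.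

(** Half of the adjunction between restriction to [k] and coinduction. *)
Lemma dual_coinduced (M : lmodType R) (phi : {linear restriction M -> k^o}) :
  exists f : {linear M -> dual}, forall x r, f x r = phi (r *: x).
Proof.
have Fd (x : M) : dual_pred (fun r => phi (r *: x : M)).
  by apply/asboolP => a r s; rewrite scalerDl -scalerA; exact: linearP.
have [|f fE] := @exists_linear _ M dual (fun x => Dual (Fd x)).
  move=> r x y; apply: dualP => s.
  change (phi (s *: (r *: x + y) : M) = phi ((s * r) *: x : M) + phi (s *: y : M)).
  by rewrite scalerDr scalerA; exact: linearD.
by exists f => x r; rewrite fE.
Qed.

(** By [dual_coinduced] it suffices to extend the [k]-functional [x |-> f x 1], which is possible
    over a field. *)
Lemma dual_injective : injective_module dual.
Proof.
move=> M N d f kf.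
(* The graph of [d x |-> f x 1] on the image of [d]; it is functional because [f] vanishes on the
   kernel of [d]. *)
pose E : set (restriction N * k) := [set u | exists x, u = (d x, f x 1)]%classic.
have fP (a : k) x y : f (c a *: x + y) 1 = a * f x 1 + f y 1.
  rewrite linearP; change (f x (1 * c a) + f y 1 = a * f x 1 + f y 1).
  have f0 : f x 0 = 0.
    by have := dual_lin (f x) (-1) 0 0; rewrite mulr0 addr0 mulN1r addNr.
  by rewrite mul1r -[c a]mulr1 -[c a * 1]addr0 dual_lin f0 addr0.
have [|b H|g gE] := @functional_extension k (restriction N) E.
- split; first by exists 0; rewrite !linear0.
  by move=> a _ _ [x ->] [y ->]; exists (c a *: x + y); rewrite fP linearP.
- by case: H => x [dx ->]; rewrite kf.
have [h hE] := dual_coinduced g; exists h => x; apply: dualP => r.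
rewrite hE -linearZ (gE (d (r *: x), f (r *: x) 1)); last by exists (r *: x).
by rewrite /= linearZ; change (f x (1 * r) = f x r); rewrite mul1r.
Qed.

(** As [x] is outside the image of [d], some functional on their span vanishes on the image and is 1
    at [x]. It extends to [N] over [k] and then coinduces to [f]. *)
Lemma dual_separates (M N : lmodType R) (d : {linear M -> N}) (x : N) :
  ~ (exists y, d y = x) -> exists f : {linear N -> dual}, (forall y, f (d y) = 0) /\ f x <> 0.
Proof.
move=> dx.
pose E : set (restriction N * k) := [set u | exists y, u = (d y + c u.2 *: x, u.2)]%classic.
have [|b H|g gE] := @functional_extension k (restriction N) E.
- split; first by exists 0; rewrite /= linear0 rmorph0 scale0r addr0.
  move=> a [u s] [v t] [y [->]] [z [->]]; exists (c a *: y + z) => /=; congr (_, _).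
  by rewrite linearP rmorphD rmorphM scalerDl -scalerA addrACA -scalerDr.
- have [y [/esym/eqP]] := H; rewrite addr_eq0 => /eqP dy; apply: contrapT => b0; apply: dx; exists (c (- b^-1) *: y).
  rewrite linearZ /= dy scalerN -scaleNr -rmorphN opprK scalerA -rmorphM mulVf ?rmorph1 ?scale1r//.
  exact/eqP.
have [h hE] := dual_coinduced g; exists h; split=> [y|].
  apply: dualP => r; rewrite hE -linearZ (gE (d (r *: y), 0))//.
  by exists (r *: y); rewrite /= rmorph0 scale0r addr0.
move=> /(congr1 (fun f : dual => f 1)); rewrite hE scale1r (gE (x, 1)).
  by move=> /= /eqP; rewrite oner_eq0.
by exists 0; rewrite /= linear0 rmorph1 scale1r add0r.
Qed.
End Coinduced.

(** * Complexes of modules and the singular projective model structure *)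

Lemma dependent_choice (T : Type) (S : T -> Type) (P : forall t, S t -> Prop) :
  (forall t, exists x, P t x) -> exists s : forall t, S t, forall t, P t (s t).
Proof. by move=> SP; exists (fun t => sval (cid (SP t))) => t; case: cid. Qed.

Section Complexes.
Variable R : pzRingType.
Implicit Types A B C D E K X Y : chMod R.

Lemma ch_factor_mono A M N (i : chModHom A N) (g : chModHom M N) :
  ch_mono i -> (forall n x, exists a, i n a = g n x) ->
  exists r : chModHom M A, forall n x, i n (r n x) = g n x.
Proof.
move=> mi ig.
have [r rE] := dependent_choice (fun n => linear_factor_mono (mi n) (ig n)).
have rd n x : r n (cm_d M n x) = cm_d A n (r (n + 1) x).
  by apply: mi; rewrite rE !cm_homd rE.
by exists (ChModHom rd).
Qed.

Lemma ch_factor_epi M B N (q : chModHom M B) (g : chModHom M N) :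
  ch_epi q -> (forall n x, q n x = 0 -> g n x = 0) ->
  exists r : chModHom B N, forall n x, r n (q n x) = g n x.
Proof.
move=> eq kg.
have [r rE] := dependent_choice (fun n => linear_factor_epi (eq n) (kg n)).
have rd n x : r n (cm_d B n x) = cm_d N n (r (n + 1) x).
  by have [y <-] := eq _ x; rewrite -cm_homd !rE cm_homd.
by exists (ChModHom rd).
Qed.

Lemma chm_comp_d A B C (g : chModHom B C) (f : chModHom A B) n x :
  (g n \o f n) (cm_d A n x) = cm_d C n ((g (n + 1) \o f (n + 1)) x).
Proof. by rewrite /= !cm_homd. Qed.
Definition chm_comp A B C (g : chModHom B C) (f : chModHom A B) : chModHom A C :=
  ChModHom (chm_comp_d g f).

Lemma chm_add_d A B (f g : chModHom A B) n x :
  (f n \+ g n) (cm_d A n x) = cm_d B n ((f (n + 1) \+ g (n + 1)) x).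
Proof. by rewrite /= !cm_homd linearD. Qed.
Definition chm_add A B (f g : chModHom A B) : chModHom A B := ChModHom (chm_add_d f g).

Lemma chm_sub_d A B (f g : chModHom A B) n x :
  (f n \- g n) (cm_d A n x) = cm_d B n ((f (n + 1) \- g (n + 1)) x).
Proof. by rewrite /= !cm_homd linearB. Qed.
Definition chm_sub A B (f g : chModHom A B) : chModHom A B := ChModHom (chm_sub_d f g).

Lemma chm_id_d A n x : (idfun : {linear A n -> A n}) (cm_d A n x) = cm_d A n x.
Proof. by []. Qed.
Definition chm_id A : chModHom A A := ChModHom (@chm_id_d A).

Lemma chm_zero_d A B n (x : A (n + 1)) :
  (\0 : {linear A n -> B n}) (cm_d A n x) = cm_d B n ((\0 : {linear A (n + 1) -> B (n + 1)}) x).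
Proof. by rewrite [RHS]linear0. Qed.
Definition chm_zero A B : chModHom A B := ChModHom (@chm_zero_d A B).

Definition chzero : chMod R :=
  @ChMod R (fun=> 'rV[R]_0) (fun=> \0) (fun _ _ => erefl).

Section Kernel.
Variables (A B : chMod R) (f : chModHom A B).

Lemma ker_d_ex n : exists d : {linear kernel (f (n + 1)) -> kernel (f n)},
  forall x, kernel_val (d x) = cm_d A n (kernel_val x).
Proof.
apply: (@linear_factor_mono _ _ _ _ (@kernel_val _ _ _ (f n))
  (cm_d A n \o @kernel_val _ _ _ (f (n + 1)))) => [|x]; first exact: val_inj.
by apply: kernel_ex; rewrite /= cm_homd kernelP linear0.
Qed.

Definition ker_d n := sval (cid (ker_d_ex n)).

Lemma ker_dE n x : kernel_val (ker_d n x) = cm_d A n (kernel_val x).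
Proof. by rewrite /ker_d; case: cid. Qed.

Lemma ker_dd n x : ker_d n (ker_d (n + 1) x) = 0.
Proof. by apply: val_inj; rewrite /= !ker_dE cm_dd. Qed.

Definition ch_kernel : chMod R := ChMod ker_dd.

Definition ch_kernel_val : chModHom ch_kernel A :=
  @ChModHom R ch_kernel A (fun n => @kernel_val _ _ _ (f n))
    (fun n x => ker_dE x).
End Kernel.

Section Prod.
Variables A B : chMod R.

Lemma ch_prod_linear n : linear (fun x : A (n + 1)%R * B (n + 1)%R => (cm_d A n x.1, cm_d B n x.2)).
Proof. by move=> a x y /=; congr (_, _); rewrite linearP. Qed.

Definition ch_prod_d n : {linear (A (n + 1)%R * B (n + 1)%R)%type -> (A n * B n)%type} :=
  HB.pack (fun x : A (n + 1)%R * B (n + 1)%R => (cm_d A n x.1, cm_d B n x.2))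
    (GRing.isLinear.Build R _ _ _ _ (@ch_prod_linear n)).

Lemma ch_prod_dd n x : ch_prod_d n (ch_prod_d (n + 1) x) = 0.
Proof. by rewrite /= !cm_dd. Qed.

Definition ch_prod : chMod R := @ChMod R (fun n => (A n * B n)%type) ch_prod_d ch_prod_dd.

Definition ch_fst : chModHom ch_prod A :=
  @ChModHom R ch_prod A (fun n => fst) (fun n x => erefl).
Definition ch_snd : chModHom ch_prod B :=
  @ChModHom R ch_prod B (fun n => snd) (fun n x => erefl).
End Prod.

(** Pulling the extension back along [u] gives an extension [P] of [X] by [K]; a splitting of it,
    followed by the projection to [E], is the lift. *)
Lemma Ext1_zero_lift X K E B (i : chModHom K E) (q : chModHom E B) (u : chModHom X B) :
  Ext1_zero X K -> short_exact i q -> exists g : chModHom X E, forall n x, q n (g n x) = u n x.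
Proof.
move=> XK [mi eq iq].
pose D := chm_sub (chm_comp q (ch_fst E X)) (chm_comp u (ch_snd E X)).
pose P := ch_kernel D; pose v := ch_kernel_val D.
have inP n e x : q n e = u n x -> exists z : P n, v n z = (e, x).
  by move=> qu; apply: kernel_ex; rewrite /= qu subrr.
have Pq n (z : P n) : q n (v n z).1 = u n (v n z).2.
  by apply/eqP; rewrite -subr_eq0; apply/eqP; exact: kernelP z.
have [j jE] : exists j : chModHom K P, forall n x, v n (j n x) = (i n x, 0).
  have lin n : linear (fun x => (i n x, 0) : ch_prod E X n).
    by move=> a x y; congr (_, _); [exact: linearP|rewrite /= scaler0 addr0].
  have [j0 j0E] := dependent_choice (fun n => exists_linear (lin n)).
  have j0d n x : j0 n (cm_d K n x) = cm_d (ch_prod E X) n (j0 (n + 1) x).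
    by rewrite !j0E /= linear0 cm_homd.
  have [|n x|j jE] := @ch_factor_mono P K _ v (ChModHom j0d).
  - by move=> n; exact: val_inj.
  - rewrite /= j0E; apply: inP; rewrite linear0; apply/iq; by exists x.
  by exists j => n x; rewrite jE /= j0E.
have [|s sE] := XK P j (chm_comp (ch_snd E X) v).
  split=> [n x y jxy|n x|n z].
  - by apply: mi; have := jE n x; rewrite jxy jE => -[].
  - by have [e /inP[z zE]] := eq n (u n x); exists z; rewrite /= zE.
  - split=> [/= z0|[x <-]]; last by rewrite /= jE.
    have /iq[x xE] : q n (v n z).1 = 0 by rewrite Pq z0 linear0.
    exists x; apply: val_inj; change (v n (j n x) = v n z).
    by rewrite jE [RHS]surjective_pairing -xE z0.
exists (chm_comp (chm_comp (ch_fst E X) v) s) => n x /=.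
by rewrite [LHS]Pq; congr (u n _); exact: sE.
Qed.

(** The lift is read off from a factorisation of [f] as [q] after [i]. First [w] lifts [u] through
    [q]; its part along the projective cokernel [C] of [i] is lifted to [A] using that [f] is epi,
    and the rest comes from [A]. *)
Lemma sing_weq_epi_lift X A B (f : chModHom A B) (u : chModHom X B) :
  termwise_projective X -> acyclic X -> ch_epi f -> sing_weq f ->
  exists g : chModHom X A, forall n x, f n (g n x) = u n x.
Proof.
move=> pX aX ef [E [i [q [fE [C [c [[mi ec ic] pC]]] [K [j [jq tK]]]]]]].
have [w wE] := Ext1_zero_lift u (tK X pX aX) jq.
have [t tE] := pC _ _ c (chm_id C) ec.
have [h hE] := pC _ _ f (chm_comp q t) ef.
(* The cokernel map [c] kills [w - t c w], which therefore comes from [A]. Then [f] sends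
   [r + h c w] to [q w = u]. *)
have [n x|r rE] := @ch_factor_mono A X E i (chm_sub w (chm_comp t (chm_comp c w))) mi.
  by apply/ic; rewrite /= linearB /= tE subrr.
exists (chm_add r (chm_comp h (chm_comp c w))) => n x.
by rewrite /= linearD /= [f n (h n _)]hE fE rE /= linearB /= wE subrK.
Qed.

Lemma epi_trivial_ker_weq A B (f : chModHom A B) : epi_trivial_ker f -> sing_weq f.
Proof.
move=> tf; exists A, (chm_id A), f; split=> //.
exists chzero, (chm_zero A chzero); split.
  split=> [n x y|n x|n x] //=.
    by exists 0; apply/rowP => -[].
  by split=> // _; exists x.
move=> A' B' q g eq; exists (chm_zero _ _) => n x.
by rewrite (_ : x = 0) ?linear0//; apply/rowP => -[].
Qed.

(** The element [e - i (r e)] depends only on [q e], and this dependence is the section. *)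
Lemma short_exact_retract_split K E X (i : chModHom K E) (q : chModHom E X) (r : chModHom E K) :
  short_exact i q -> (forall n x, r n (i n x) = x) ->
  exists s : chModHom X E, forall n x, q n (s n x) = x.
Proof.
move=> [mi eq iq] rE.
have [n x /iq[y <-]|s sE] := @ch_factor_epi E X E q (chm_sub (chm_id E) (chm_comp i r)) eq.
  by rewrite /= rE subrr.
exists s => n x; have [e <-] := eq n x; rewrite sE /= linearB /=.
by rewrite (_ : q n (i n _) = 0) ?subr0//; apply/iq; eexists.
Qed.
End Complexes.

(** * Truncated projective resolutions *)

Lemma int_existT_inj (S : int -> Type) m (x y : S m) : existT S m x = existT S m y -> x = y.
Proof.
move=> e; have := EqdepFacts.eq_sigT_snd e.
by rewrite (eq_irrelevance (EqdepFacts.eq_sigT_fst e) erefl).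
Qed.

(** Upward recursion from degree [n]: [P] is the invariant that provides a next value, [Q] the
    compatibility of neighbours. As [n + i.+1] and [n + i + 1] are only provably equal, the
    recursion runs on pairs of a degree and a value. *)
Lemma int_dependent_choice (S : int -> Type) (P : forall m, S m -> Prop)
    (Q : forall m, S m -> S (m + 1) -> Prop) (n : int) (x : S n) :
  P n x -> (forall m, m < n -> exists y, P m y) ->
  (forall m y z, m < n -> P m y -> P (m + 1) z -> Q m y z) ->
  (forall m y, n <= m -> P m y -> exists2 z, P (m + 1) z & Q m y z) ->
  exists s : forall m, S m, s n = x /\ forall m, P m (s m) /\ Q m (s m) (s (m + 1)).
Proof.
move=> Px low Qlow step.
have [next nextP] : exists next : {m & S m} -> {m & S m}, forall m y, n <= m -> P m y ->
    exists z, [/\ next (existT S m y) = existT S (m + 1) z, P (m + 1) z & Q m y z].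
  have [|next nextP] := @dependent_choice {m & S m} (fun=> {m & S m})
    (fun u v => n <= tag u -> P _ (tagged u) ->
       exists z, [/\ v = existT S (tag u + 1) z, P (tag u + 1) z & Q _ (tagged u) z]).
    move=> [m y] /=; have [[nm Py]|nmP] := pselect (n <= m /\ P m y).
      by have [z Pz Qz] := step m y nm Py; exists (existT S (m + 1) z) => _ _; exists z.
    by exists (existT S m y) => nm Py; case: nmP.
  by exists next => m y; exact: (nextP (existT S m y)).
pose u i := iter i next (existT S n x).
have uP i : exists y : S (n + i%:Z), u i = existT S _ y /\ P _ y.
  elim: i => [|i [y [uy Py]]]; first by rewrite addr0; exists x.
  have [|z [nz Pz _]] := nextP _ y _ Py; first by lia.
  have -> : n + i.+1%:Z = n + i%:Z + 1 by lia.
  by exists z; rewrite -nz -uy.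
have [m|s sP] := @dependent_choice int S
    (fun m y => P m y /\ (n <= m -> u `|m - n|%N = existT S m y)).
  have [mn|nm] := ltP m n.
    by have [y Py] := low m mn; exists y.
  move: (uP `|m - n|%N); have -> : n + `|m - n|%N%:Z = m by lia.
  by move=> [y [uy Py]]; exists y.
exists s; split=> [|m].
  apply/esym/int_existT_inj; rewrite -(sP n).2//.
  by rewrite subrr.
split; first exact: (sP m).1.
have [mn|nm] := ltP m n; first by apply: Qlow => //; exact: (sP _).1.
have [z [nz Pz Qz]] := nextP m (s m) nm (sP m).1.
suff -> : s (m + 1) = z by [].
apply: int_existT_inj; rewrite -nz -(sP m).2// -(sP (m + 1)).2; last by lia.
by have -> : `|(m + 1 - n)%R|%N = `|m - n|%N.+1 by lia.
Qed.

Section Resolution.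
Variable R : pzRingType.

(* For a projective resolution T of N_n, placed in degrees >= n, the N_m with m > n are the
   syzygies and iota their inclusions; for m < n everything vanishes. *)
Section Triviality.
Variables (T : chMod R) (N : int -> lmodType R) (n : int).
Variables (pi : forall m, {linear T m -> N m}) (iota : forall m, {linear N (m + 1) -> T m}).
Hypothesis dE : forall m x, cm_d T m x = iota m (pi (m + 1) x).
Hypothesis pi_surj : forall m y, exists x, pi m x = y.
Hypothesis exactT : forall m x, pi m x = 0 <-> exists y, iota m y = x.
Hypothesis iota_inj : forall m, n <= m -> injective (iota m).
Hypothesis N_injective : forall m, m <= n -> injective_module (N m).
Hypothesis T0 : forall m, m < n -> forall x : T m, x = 0.

Lemma pi_d m x : pi m (cm_d T m x) = 0.
Proof. by rewrite dE; apply/exactT; eexists. Qed.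

Lemma pi0_d m x : pi m x = 0 -> exists y, cm_d T m y = x.
Proof. by move=> /exactT[y <-]; have [z <-] := pi_surj y; exists z; rewrite dE. Qed.

(** A chain section is built upwards from degree [n - 1]. Above degree [n] the obstruction is a
    cycle of [T], hence a boundary; in degree [n] its class in [N n] is removed by injectivity of
    [N n] and acyclicity of [X]. *)
Lemma resolution_sing_trivial : sing_trivial T.
Proof.
move=> X pX aX E i q [mi eq iq].
have qi m x : q m (i m x) = 0 by apply/iq; exists x.
(* The second clause provides the next value elementwise; projectivity of [X (m + 1)] will make it
   linear. *)
pose good m (s : {linear X m -> E m}) := (forall x, q m (s x) = x) /\
  forall x, exists e, cm_d E m e = s (cm_d X m x) /\ q (m + 1) e = x.
(* [tau e] is the defect of [e] as a value over [q e]; subtracting from [e] a [t'] with boundary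
   [tau e] removes it. *)
have pairE m (s : {linear X m -> E m}) : (forall x, q m (s x) = x) -> exists
    tau : {linear E (m + 1) -> T m}, forall e, i m (tau e) = cm_d E m e - s (cm_d X m (q (m + 1) e)).
  move=> qs; have [|e|tau tauE] := @linear_factor_mono _ _ _ _ (i m)
    (cm_d E m \- (s \o cm_d X m \o q (m + 1))).
  - exact: mi.
  - by apply/iq; rewrite /= linearB/= cm_homd qs subrr.
  - by exists tau.
have q_inj m x y : m < n -> q m x = q m y -> x = y.
  move=> mn qxy; apply/eqP; rewrite -subr_eq0; apply/eqP.
  have /iq[t <-] : q m (x - y) = 0 by rewrite linearB /= qxy subrr.
  by rewrite (T0 mn t) linear0.
have low m : m < n -> exists s, good m s.
  move=> mn; have [|s sE] := pX m _ _ (q m) idfun; first exact: (eq m).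
  exists s; split=> // x; have [e <-] := eq _ x; exists e; split=> //.
  by apply: (q_inj _ _ _ mn); rewrite sE cm_homd.
have [|s0 gs0] := low (n - 1); first by lia.
have [|||s [_ sP]] := @int_dependent_choice (fun m => {linear X m -> E m}) good
    (fun m s s' => forall x, cm_d E m (s' x) = s (cm_d X m x)) (n - 1) s0 gs0.
- by move=> m mn; apply: low; lia.
- move=> m s s' mn [qs _] [qs' _] x; apply: (q_inj m); first by lia.
  by rewrite qs cm_homd qs'.
- move=> m s nm [qs gs].
  have [|D DE] := @exists_linear R (E (m + 1)) (E m * X (m + 1)%R)%type
      (fun e => (cm_d E m e, q (m + 1) e)).
    by move=> a x y; congr (_, _); rewrite linearP.
  have [|S SE] := @exists_linear R (X (m + 1)) (E m * X (m + 1)%R)%type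
      (fun x => (s (cm_d X m x), x)).
    by move=> a x y; congr (_, _); rewrite ?linearP.
  have [x|s' s'E] := projective_lift (q := D) (f := S) (pX (m + 1)).
    by have [e [de qe]] := gs x; exists e; rewrite DE SE de qe.
  have ds' x : cm_d E m (s' x) = s (cm_d X m x).
    by have := s'E x; rewrite DE SE => -[].
  have qs' x : q (m + 1) (s' x) = x by have := s'E x; rewrite DE SE => -[].
  have [tau tauE] := pairE _ s' qs'.
  (* If [n <= m], then [tau e] is a cycle, and injectivity of [iota m] makes it a boundary. *)
  have [/iota_inj inj|mn] := leP n m.
    exists s' => //; split=> // x; have [e <-] := eq _ x.
    have [t' t'E] : exists t', cm_d T (m + 1) t' = tau e.
      apply/pi0_d/inj; rewrite linear0 -dE; apply: (mi m); rewrite linear0 cm_homd tauE.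
      by rewrite linearB /= cm_dd ds' cm_dd linear0 subrr.
    exists (e - i _ t'); rewrite !linearB /= qi subr0; split=> //.
    by rewrite -(cm_homd i) t'E tauE subKr.
  (* Now [m + 1 = n]. The class [pi (tau e)] depends only on [q e], through [theta]. By acyclicity
     [theta] kills the cycles of [X], so it factors as [psi] after the differential; a lift [g] of
     [psi] corrects [s'], and since [T m] is zero this leaves the boundary of [s'] unchanged. *)
  have [e qe0|theta thetaE] := linear_factor_epi (q := q (m + 1 + 1)) (g := pi (m + 1) \o tau) (eq _).
    have /iq[t te] := qe0.
    rewrite /= (_ : tau e = cm_d T _ t) ?pi_d//; apply: mi.
    by rewrite tauE qe0 !linear0 addr0 -te cm_homd.
  have [|x dx|psi psiE] := N_injective (m := m + 1) _ (d := cm_d X (m + 1)) (f := theta).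
  - by lia.
  -
    have [z <-] := aX _ _ dx; have [e <-] := eq _ z.
    rewrite -cm_homd thetaE /= (_ : tau _ = 0) ?linear0//; apply: mi.
    by rewrite tauE linear0 cm_dd cm_homd cm_dd linear0 subrr.
  have [x|g gE] := projective_lift (q := pi (m + 1)) (f := psi) (pX _); first exact: pi_surj.
  exists (s' \+ (i (m + 1) \o g)); last first.
    by move=> x /=; rewrite linearD /= ds' -cm_homd (T0 mn (cm_d _ _ _)) linear0 addr0.
  split=> [x|x] /=; first by rewrite linearD /= qs' qi addr0.
  have [e <-] := eq _ x.
  have [t' t'E] : exists t', cm_d T (m + 1) t' = tau e - g (cm_d X (m + 1) (q _ e)).
    by apply: pi0_d; rewrite linearB /= gE psiE thetaE subrr.
  exists (e - i _ t'); rewrite !linearB /= qi subr0; split=> //.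
  by rewrite -(cm_homd i) t'E linearB /= tauE opprB addrCA subKr addrC.
have sd m x : s m (cm_d X m x) = cm_d E m (s (m + 1) x) by rewrite (sP m).2.
by exists (ChModHom sd) => m; exact: (sP m).1.1.
Qed.

(** The comparison argument for resolutions: zero below [n], a lift of [Phi] in degree [n], then
    exactness upwards. The invariant of the recursion says that [f] sends boundaries of [Q] to
    boundaries of [T]. *)
Lemma resolution_lift (Q : chMod R) (Phi : {linear Q n -> N n}) : termwise_projective Q ->
  (forall x, Phi (cm_d Q n x) = 0) ->
  exists f : chModHom Q T, forall x, pi n (f n x) = Phi x.
Proof.
move=> pQ dPhi.
have [g gE] := pQ n _ _ (pi n) Phi (@pi_surj n).
have [||||f [fn fP]] := @int_dependent_choice (fun m => {linear Q m -> T m})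
    (fun m f => forall x, pi m (f (cm_d Q m x)) = 0)
    (fun m f f' => forall x, cm_d T m (f' x) = f (cm_d Q m x)) n g.
- by move=> x; rewrite gE.
- by move=> m mn; exists \0 => x; rewrite linear0.
- by move=> m f f' mn _ _ x; rewrite [LHS](T0 mn) [RHS](T0 mn).
- move=> m f nm pf.
  have [x|f' f'E] := projective_lift (q := cm_d T m) (f := f \o cm_d Q m) (pQ _).
    exact/pi0_d/pf.
  exists f' => // x; apply: (iota_inj nm).
  by rewrite linear0 -dE f'E /= cm_dd linear0.
have fd m x : f m (cm_d Q m x) = cm_d T m (f (m + 1) x) by rewrite (fP m).2.
by exists (ChModHom fd) => x; rewrite /= fn.
Qed.
End Triviality.

(** * The path fibration *)

Section Path.
Variable T : chMod R.

Lemma path_linear m : linear (fun x : T (m + 1)%R * T (m + 1 + 1)%R =>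
  (cm_d T m x.1, x.1 - cm_d T (m + 1) x.2)).
Proof.
by move=> a x y /=; congr (_, _); rewrite /= linearP// scalerBr opprD addrACA.
Qed.

Definition path_d m : {linear (T (m + 1)%R * T (m + 1 + 1)%R)%type -> (T m * T (m + 1)%R)%type} :=
  HB.pack (fun x : T (m + 1)%R * T (m + 1 + 1)%R => (cm_d T m x.1, x.1 - cm_d T (m + 1) x.2))
    (GRing.isLinear.Build R _ _ _ _ (@path_linear m)).

Lemma path_dd m x : path_d m (path_d (m + 1) x) = 0.
Proof. by rewrite /= linearB /= !cm_dd subr0 subrr. Qed.

(** A cycle [(a, b)] satisfies [a = d b]: the second component witnesses that the first is a
    boundary. *)
Definition path_ch : chMod R := @ChMod R (fun m => (T m * T (m + 1)%R)%type) path_d path_dd.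

Definition path_proj : chModHom path_ch T :=
  @ChModHom R path_ch T (fun m => fst) (fun m x => erefl).

Lemma shift_dd m x : (\- cm_d T (m + 1)) ((\- cm_d T (m + 1 + 1)) x) = 0.
Proof. by rewrite /= linearN /= opprK cm_dd. Qed.

Definition shift_ch : chMod R :=
  @ChMod R (fun m => T (m + 1)) (fun m => \- cm_d T (m + 1)) shift_dd.

Lemma path_short_exact : exists i : chModHom shift_ch path_ch, short_exact i path_proj.
Proof.
have lin m : linear (fun x : shift_ch m => (0, x) : path_ch m).
  by move=> a x y; congr (_, _); rewrite /= scaler0 addr0.
have [j jE] := dependent_choice (fun m => exists_linear (lin m)).
have jd m x : j m (cm_d shift_ch m x) = cm_d path_ch m (j (m + 1) x).
  by rewrite !jE /= linear0 sub0r.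
exists (ChModHom jd); split=> [m x y /=|m x|m x] /=.
- by rewrite !jE => -[].
- by exists (x, 0).
- split=> [x0|[y <-]]; last by rewrite jE.
  by exists x.2; rewrite jE [RHS]surjective_pairing x0.
Qed.

End Path.
End Resolution.

(** * Syzygies and the test fibration *)

Section ResolutionExistence.
Variable R : pzRingType.

Lemma projective_prod (P Q : lmodType R) :
  projective_module P -> projective_module Q -> projective_module (P * Q)%type.
Proof.
move=> pP pQ M N q f sq.
have [|iP iPE] := @exists_linear R P (P * Q)%type (fun x => (x, 0)).
  by move=> a x y; congr (_, _); rewrite /= scaler0 addr0.
have [|iQ iQE] := @exists_linear R Q (P * Q)%type (fun x => (0, x)).
  by move=> a x y; congr (_, _); rewrite /= scaler0 addr0.
have [g gE] := pP _ _ q (f \o iP) sq; have [h hE] := pQ _ _ q (f \o iQ) sq.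
exists ((g \o fst) \+ (h \o snd)) => -[x y] /=.
rewrite linearD /= gE hE /= -linearD iPE iQE; congr (f _).
by congr (_, _); rewrite /= ?addr0 ?add0r.
Qed.

Lemma zero_projective : projective_module 'rV[R]_0.
Proof.
move=> M N q f _; exists \0 => x.
by rewrite (_ : x = 0) ?linear0//; apply/rowP => -[].
Qed.

Lemma zero_injective : injective_module 'rV[R]_0.
Proof. by move=> M N d f _; exists \0 => x; apply/rowP => -[]. Qed.

Section Syzygies.
Variable J : lmodType R.

Definition Omega (M : lmodType R) : lmodType R := kernel (free_cover M).

Definition syzygy (a : int) : lmodType R :=
  match a with Posz i => iter i Omega J | Negz _ => 'rV[R]_0 end.

Definition syzygy_cover (a : int) : lmodType R :=
  match a with Posz i => freeMod R (iter i Omega J) | Negz _ => 'rV[R]_0 end.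

Definition syzygy_proj (a : int) : {linear syzygy_cover a -> syzygy a} :=
  match a with Posz i => free_cover (iter i Omega J) | Negz _ => idfun end.

Lemma syzygy_proj_surj a y : exists x, syzygy_proj a x = y.
Proof. by case: a y => i y; [exact: free_cover_surj|exists y]. Qed.

Lemma syzygy_cover_projective a : projective_module (syzygy_cover a).
Proof. by case: a => i; [exact: freeMod_projective|exact: zero_projective]. Qed.

Lemma syzygy_cover0 a : a < 0 -> forall x : syzygy_cover a, x = 0.
Proof. by case: a => // i _ x; apply/rowP => -[]. Qed.

Lemma syzygy_injective a : injective_module J -> a <= 0 -> injective_module (syzygy a).
Proof. by case: a => [[|i]|i] // injJ _; exact: zero_injective. Qed.

Lemma syzygy_incl a : exists iota : {linear syzygy (a + 1) -> syzygy_cover a},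
  (forall x, syzygy_proj a x = 0 <-> exists y, iota y = x) /\ (0 <= a -> injective iota).
Proof.
case: a => i.
  have -> : Posz i + 1 = Posz i.+1 by lia.
  exists (@kernel_val _ _ _ (free_cover (iter i Omega J))); split=> [x|_]; last exact: val_inj.
  by split=> [/kernel_ex//|[y <-]]; exact: kernelP.
(* For negative [a] the cover is zero. At [a = -1] the source is [J], which is why injectivity is
   claimed only from 0 on. *)
exists \0; split=> // x; have -> : x = 0 by apply/rowP => -[].
by split=> _; [exists 0|exact: linear0].
Qed.
End Syzygies.

(* T is a projective resolution of J placed in degrees > n, and C its path complex. *)
Lemma test_fibration (J : lmodType R) (n : int) : injective_module J ->
  exists (C T : chMod R) (q : chModHom C T),
    [/\ termwise_projective C, termwise_projective T, ch_epi q, epi_trivial_ker q &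
     forall (Q : chMod R) (Phi : {linear Q (n + 1) -> J}), termwise_projective Q ->
       (forall x, Phi (cm_d Q (n + 1) x) = 0) ->
       exists f : chModHom Q T, forall x c,
         cm_d C n c = 0 -> q (n + 1) c = f (n + 1) x -> Phi x = 0].
Proof.
move=> injJ.
pose N m := syzygy J (m - (n + 1)); pose T0 m := syzygy_cover J (m - (n + 1)).
pose pi m : {linear T0 m -> N m} := syzygy_proj J (m - (n + 1)).
have [m|iota iotaP] := @dependent_choice int (fun m => {linear N (m + 1) -> T0 m})
    (fun m iota => (forall x, pi m x = 0 <-> exists y, iota y = x) /\
      (n + 1 <= m -> injective iota)).
  rewrite /N; have -> : m + 1 - (n + 1) = m - (n + 1) + 1 by lia.
  have [iota [e i]] := syzygy_incl J (m - (n + 1)).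
  by exists iota; split=> // nm; apply: i; lia.
have dd m x : (iota m \o pi (m + 1)) ((iota (m + 1) \o pi (m + 1 + 1)) x) = 0.
  by rewrite /= (_ : pi (m + 1) _ = 0) ?linear0//; apply/(iotaP _).1; eexists.
pose T := ChMod dd.
have pT : termwise_projective T by move=> m; exact: syzygy_cover_projective.
have piS m y : exists x, pi m x = y by exact: syzygy_proj_surj.
have T00 m : m < n + 1 -> forall x : T m, x = 0.
  by move=> mn; apply: syzygy_cover0; lia.
have injN m : m <= n + 1 -> injective_module (N m).
  by move=> mn; apply: syzygy_injective; last lia.
exists (path_ch T), T, (path_proj T); split=> //.
- by move=> m; exact: projective_prod.
- by move=> m y; exists (y, 0).
- have [i iP] := path_short_exact T; exists (shift_ch T), i; split=> //.
  (* The kernel of the path projection is [T] shifted down with opposite differential: again a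
     resolution of [J], now starting in degree [n]. *)
  apply: (@resolution_sing_trivial R (shift_ch T) (fun m => N (m + 1)) n
    (fun m => pi (m + 1)) (fun m => \- iota (m + 1))) => //.
  + by move=> m y; exact: piS.
  + move=> m x; have [e _] := iotaP (m + 1); split=> [/e[y <-]|[y <-]].
      by exists (- y); rewrite /= linearN opprK.
    by apply/e; exists (- y); rewrite linearN.
  + by move=> m nm x y /= /oppr_inj; apply: (iotaP (m + 1)).2; lia.
  + by move=> m mn; apply: injN; lia.
  + by move=> m mn; apply: T00; lia.
move=> Q Phi pQ dPhi.
(* [N (n + 1)] is [J] only after simplifying its index; [th] is the identity carried across. *)
have [th th_inj] : exists th : {linear J -> N (n + 1)}, injective th.
  by rewrite /N subrr; exists idfun.
have [|x|f fE] := @resolution_lift R T N (n + 1) pi iota (fun _ _ => erefl) piS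
  (fun m => (iotaP m).1) (fun m => (iotaP m).2) T00 Q (th \o Phi).
- by [].
- by rewrite /= dPhi linear0.
(* The cycle condition gives [a = d b], so [f x] is a boundary of [T] and [pi] kills it. *)
exists f => x [a b] [_ /eqP]; rewrite subr_eq0 => /eqP -> ab.
apply: th_inj; rewrite linear0 -[LHS]fE -ab.
by apply/(iotaP (n + 1)).1; eexists.
Qed.
End ResolutionExistence.

(** * Disk complexes *)

Section Transport.
Implicit Type S : int -> Type.

Definition transport S a b (e : a = b) : S a -> S b :=
  match e with erefl => idfun end.

Lemma transport_id S a (e : a = a) (x : S a) : transport e x = x.
Proof. by rewrite (eq_irrelevance e erefl). Qed.

Lemma transport_nat S S' (f : forall n, S n -> S' n) a b (e : a = b) x :
  f b (transport e x) = transport e (f a x).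
Proof. by case: b / e. Qed.

Variables (S : int -> Type) (d : forall n, S (n + 1) -> S n).

(** The differential out of degree [n] instead of [n + 1], as needed for disks with terms indexed by
    [n] and [n - 1]. *)
Definition shifted_d n (x : S n) : S (n - 1) := d (transport (esym (subrK 1 n)) x).

Lemma transport_shifted_d n (x : S (n + 1)) : transport (addrK 1 n) (shifted_d x) = d x.
Proof.
rewrite /shifted_d; move: (addrK 1 n) (esym (subrK 1 (n + 1))).
by move: (n + 1 - 1) => m e; subst m => e; rewrite !transport_id.
Qed.

Lemma shifted_d_d (z : forall n, S n) : (forall n x, d (d x) = z n) ->
  forall n (x : S (n + 1)), shifted_d (d x) = z (n - 1).
Proof.
move=> dd n; rewrite /shifted_d; move: (esym (subrK 1 n)).
by move: (n - 1) => m e x; subst n; exact: dd.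
Qed.
End Transport.

Lemma shifted_d_nat (S S' : int -> Type) (d : forall n, S (n + 1) -> S n)
    (d' : forall n, S' (n + 1) -> S' n) (f : forall n, S n -> S' n) :
  (forall n x, f n (d n x) = d' n (f (n + 1) x)) ->
  forall n x, f (n - 1) (shifted_d d x) = shifted_d d' (f n x).
Proof. by move=> fd n x; rewrite /shifted_d fd (transport_nat f). Qed.

Section Disk.
Variable R : pzRingType.
Implicit Type L : int -> lmodType R.

Lemma transport_linear L a b (e : a = b) : linear (transport (S := L) e).
Proof. by case: b / e. Qed.

Lemma transport0 L a b (e : a = b) : transport (S := L) e 0 = 0.
Proof. by case: b / e. Qed.

Local Notation ch_prev := (fun C : chMod R => @shifted_d (cm_obj C) (fun n => cm_d C n)).

Lemma shifted_d_linear (C : chMod R) n : linear (@ch_prev C n).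
Proof. by move=> a x y; rewrite /shifted_d transport_linear linearP. Qed.

Section DiskComplex.
Variable L : int -> lmodType R.

Definition disk_fun n (x : L (n + 1)%R * L (n + 1 - 1)%R) : L n * L (n - 1)%R :=
  (transport (S := L) (addrK 1 n) x.2, 0).

Lemma disk_fun_linear n : linear (@disk_fun n).
Proof.
by move=> a x y; congr (_, _); [exact: transport_linear|rewrite /= scaler0 addr0].
Qed.

Definition disk_d n : {linear (L (n + 1)%R * L (n + 1 - 1)%R)%type -> (L n * L (n - 1)%R)%type} :=
  HB.pack (@disk_fun n) (GRing.isLinear.Build R _ _ _ _ (@disk_fun_linear n)).

Lemma disk_dd n x : disk_d n (disk_d (n + 1) x) = 0.
Proof.
by congr (_, _); exact: transport0.
Qed.

Definition disk_ch : chMod R := @ChMod R (fun n => (L n * L (n - 1)%R)%type) disk_d disk_dd.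

Lemma shifted_d_disk n (x : disk_ch n) : (ch_prev disk_ch _ x).1 = x.2.
Proof.
(* With the index equalities generalised, [n] can be replaced by [m + 1]; equality proofs on [int]
   are unique. *)
have gen m (e1 : n = m + 1) (e2 : m + 1 - 1 = m) (e3 : n - 1 = m) :
    transport (S := L) e2 (transport (S := cm_obj disk_ch) e1 x).2 = transport (S := L) e3 x.2.
  by subst n; rewrite transport_id (eq_irrelevance e2 e3).
exact: (gen (n - 1) (esym (subrK 1 n)) (addrK 1 (n - 1)) erefl).
Qed.

(** A chain map from [E] to a disk is the same as an arbitrary family of maps [E n -> L n], the
    second component being the family after the differential. The extension splits degreewise, and
    the first components of the retractions [rho] yield a chain retraction. *)
Lemma disk_sing_trivial : sing_trivial disk_ch.
Proof.
move=> X pX _ E i q se; have [mi eq iq] := se.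
have [sg sgE] := dependent_choice (fun n => pX n _ _ (q n) idfun (eq n)).
have [n|rho rhoE] := @dependent_choice int (fun n => {linear E n -> disk_ch n})
    (fun n rho => forall e, i n (rho e) = e - sg n (q n e)).
  apply: (linear_factor_mono (i := i n) (g := idfun \- (sg n \o q n)) (mi n)) => e.
  by apply/iq; rewrite /= linearB /= sgE subrr.
have rhoi n x : rho n (i n x) = x.
  have qi : q n (i n x) = 0 by apply/iq; exists x.
  by apply: mi; rewrite rhoE qi linear0 subr0.
have lin n : linear (fun e : E n => ((rho n e).1, (rho (n - 1) (ch_prev E _ e)).1) : disk_ch n).
  by move=> a x y; congr (_, _); rewrite ?shifted_d_linear linearP.
have [r rE] := dependent_choice (fun n => exists_linear (lin n)).
have rd n x : r n (cm_d E n x) = cm_d disk_ch n (r (n + 1) x).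
  rewrite !rE; congr (_, _) => /=.
    rewrite -(transport_nat (S := cm_obj E) (S' := L) (fun m y => (rho m y).1)).
    by rewrite transport_shifted_d.
  by rewrite (shifted_d_d (z := fun=> 0) (@cm_dd _ E)) linear0.
apply: (@short_exact_retract_split _ _ _ _ i q (ChModHom rd) se) => n x.
rewrite /= rE rhoi -(shifted_d_nat (S := cm_obj disk_ch) (S' := cm_obj E)
  (d := fun n => cm_d disk_ch n) (f := fun n => i n)); last exact: cm_homd.
by rewrite rhoi shifted_d_disk -surjective_pairing.
Qed.
End DiskComplex.
End Disk.

(** * The unit and counit on projectives *)

Lemma projective_retract (R : pzRingType) (P Q : lmodType R) (a : {linear Q -> P})
    (b : {linear P -> Q}) :
  projective_module P -> (forall x, b (a x) = x) -> projective_module Q.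
Proof.
move=> pP ba M N q f sq; have [g gE] := pP _ _ q (f \o b) sq.
by exists (g \o a) => x; rewrite /= gE /= ba.
Qed.

Section HeckeAlgebra.
Variables (k : fieldType) (G : topGroupType) (p : nat) (I : openProP G p).
Local Notation X := (indX k I).
Local Notation H := (hecke k I).

Lemma hecke_scalar_subproof (a : k) : hecke_pred (fun f : X => a *: f).
Proof.
apply/asboolP; split=> [b u v|g f]; last by rewrite linearZ.
by rewrite scalerDr !scalerA mulrC.
Qed.
Definition hecke_scalar (a : k) : H := Hecke (hecke_scalar_subproof a).

Lemma hecke_scalar_zmod : zmod_morphism hecke_scalar.
Proof. by move=> a b; apply: heckeP => x; exact: scalerBl. Qed.
Lemma hecke_scalar_monoid : monoid_morphism hecke_scalar.
Proof.
split=> [|a b]; apply: heckeP => x; first exact: scale1r.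
by rewrite /= mulrC scalerA.
Qed.
HB.instance Definition _ := GRing.isZmodMorphism.Build k H hecke_scalar hecke_scalar_zmod.
HB.instance Definition _ := GRing.isMonoidMorphism.Build k H hecke_scalar hecke_scalar_monoid.

(** By uniqueness in Frobenius reciprocity. Together with [hecke_of_invar] this identifies [H] with
    the invariants of [X] by evaluation at [ind1]. *)
Lemma hecke_inj_ind1 (h1 h2 : H) : h1 (ind1 k I) = h2 (ind1 k I) -> h1 = h2.
Proof.
move=> h12; apply: heckeP => x.
have inv : inv_pred I (h2 (ind1 k I) : indRep k I).
  by apply/asboolP => i Ii /=; rewrite -hecke_act ind1_inv.
have hE (h : H) : h (ind1 k I) = h2 (ind1 k I) -> forall y, h y = frob (Invar inv) y.
  by move=> h_ind1; apply: (@frob_unique _ _ _ _ (indRep k I) h) => // g f; exact: hecke_act.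
by rewrite (hE h1 h12) -(hE h2 erefl).
Qed.

Lemma hecke_of_invar (x : X) : inv_pred I (x : indRep k I) -> exists h : H, h (ind1 k I) = x.
Proof.
move=> xI; have hP : hecke_pred (frob (Invar xI)).
  by apply/asboolP; split; [exact: (@frob_linear _ _ _ _ (indRep k I))|exact: (@frob_act _ _ _ _ (indRep k I))].
by exists (Hecke hP); rewrite /= frob_ind1.
Qed.
End HeckeAlgebra.

Section Unit.
Variables (k : fieldType) (G : topGroupType) (p : nat) (I : openProP G p).
Local Notation X := (indX k I).
Local Notation H := (hecke k I).
Local Notation e := (ind1 k I).

Definition id_hom (V : smoothRep k G) : repHom V V := @RepHom k G V V idfun (fun _ _ => erefl).

Definition F_unit (M : lmodType H) : {linear M -> invar I (F_obj M)} := adj_fun (id_hom (F_obj M)).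

Lemma F_unitE (M : lmodType H) m : invar_val (F_unit M m) = tens e m.
Proof. by []. Qed.

Lemma F_unit_nat (M N : lmodType H) (f : {linear M -> N}) m :
  U_map I (F_map f) (F_unit M m) = F_unit N (f m).
Proof. by apply: val_inj; rewrite /= F_linE. Qed.

Lemma counit_F_unit (M : lmodType H) t : counit_rep I (F_obj M) (F_map (F_unit M) t) = t.
Proof.
move: t; apply: (@tens_lin_ext _ _ _ _ _ _ (counit_lin I (F_obj M) \o F_lin (F_unit M)) idfun) => x m /=.
by rewrite F_linE counit_linE -(adj_frob (g := id_hom (F_obj M)) (m := m)).
Qed.

Lemma U_counit_unit (V : smoothRep k G) v : U_map I (counit_rep I V) (F_unit _ v) = v.
Proof. by apply: val_inj; rewrite /= counit_linE frob_ind1. Qed.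

Lemma counit_nat (V W : smoothRep k G) (f : repHom V W) t :
  counit_rep I W (F_map (U_map I f) t) = f (counit_rep I V t).
Proof.
move: t; apply: (@tens_lin_ext _ _ _ _ _ _ (counit_lin I W \o F_lin (U_map I f))
  (f \o counit_lin I V)) => x v /=.
by rewrite F_linE !counit_linE -frob_nat.
Qed.

Lemma F_map_comp (L M N : lmodType H) (g : {linear M -> N}) (f : {linear L -> M})
    (h : {linear L -> N}) t : (forall x, g (f x) = h x) -> F_map g (F_map f t) = F_map h t.
Proof.
move=> gf; move: t; apply: (@tens_lin_ext _ _ _ _ _ _ (F_lin g \o F_lin f) (F_lin h)) => x m /=.
by rewrite !F_linE gf.
Qed.

Lemma F_map_id (M : lmodType H) (f : {linear M -> M}) t :
  (forall x, f x = x) -> F_map f t = t.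
Proof.
move=> fid; move: t; apply: (@tens_lin_ext _ _ _ _ _ _ (F_lin f) idfun) => x m /=.
by rewrite F_linE fid.
Qed.

Section Free.
Variable S : choiceType.
Local Notation L := (freeMod H S).

Lemma coord_balanced (s : S) : balanced (fun (x : X) (m : L) => (m s : H) x).
Proof.
split=> [x1 x2 m|x m1 m2|a x m|h x m] //; first exact: linearD.
exact: linearZ.
Qed.

(** The projection of the tensor product, a direct sum of copies of [X], to its component at [s]. *)
Definition coord s : {linear tensor L -> X} := tens_lift_fun (coord_balanced s).

Lemma coordE s x (m : L) : coord s (tens x m) = (m s : H) x.
Proof. exact: tens_liftE. Qed.

Lemma coord_act s g (t : F_obj L) : coord s (act g t) = ind_act g (coord s t).
Proof.
move: t; apply: (@tens_lin_ext _ _ _ _ _ _ (coord s \o tens_act L g)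
  (@ind_act k G p I g \o coord s)) => x m /=.
by rewrite tens_actE !coordE hecke_act.
Qed.

Lemma tens_sumr (M : lmodType H) (x : X) (T : Type) (r : seq T) (F : T -> M) :
  tens x (\sum_(i <- r) F i) = \sum_(i <- r) tens x (F i).
Proof. by elim/big_rec2: _ => [|i y1 y2 _ <-]; [exact: tensr0|exact: tensDr]. Qed.

(** Allowing every list beyond [r0] lets the induction on tensors merge the lists of two
    summands. *)
Lemma coord_decomp (t : tensor L) : exists r0 : seq S, forall r, uniq r -> {subset r0 <= r} ->
  t = \sum_(s <- r) tens (coord s t) (std_basis H s).
Proof.
elim/tens_ind: t => [|a x m t [r0 IHt]].
  exists [::] => r _ _; rewrite big1// => s _.
  by rewrite linear0 -(scale0r 0) tensZ scale0r.
have [r1 _ r1P] := freeMod_supp m; exists (r0 ++ r1) => r ur rr.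
have {}r1P s : s \notin r -> m s = 0.
  by move=> sr; apply: r1P; apply: contra sr => sr; apply: rr; rewrite mem_cat sr orbT.
rewrite [in LHS](IHt r ur); last by move=> s sr; apply: rr; rewrite mem_cat sr.
rewrite [in LHS](freeMod_decomp ur r1P) tens_sumr scaler_sumr -big_split /=.
apply: eq_bigr => s _; rewrite linearP coordE tensDl tensZ; congr (a *: _ + _).
by rewrite -tensH.
Qed.

Lemma F_unit_free_inj : injective (F_unit L).
Proof.
move=> m1 m2 e12; apply: freeModP => s; apply: hecke_inj_ind1.
by rewrite -!coordE -!F_unitE e12.
Qed.

(** The coordinates of an invariant tensor are invariant, hence of the form [h e], and [h] moves
    across the tensor sign. *)
Lemma F_unit_free_surj (v : invar I (F_obj L)) : exists m, F_unit L m = v.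
Proof.
have [r0 r0P] := coord_decomp (invar_val v).
have [s|h hE] := @dependent_choice S (fun=> H) (fun s h => h e = coord s (invar_val v)).
  by apply: hecke_of_invar; apply/asboolP => i Ii /=; rewrite -coord_act invarP.
exists (\sum_(s <- undup r0) h s *: std_basis H s); apply: val_inj.
rewrite /= tens_sumr [RHS](r0P (undup r0)) ?undup_uniq//; last by move=> s; rewrite mem_undup.
by apply: eq_bigr => s _; rewrite -tensH hE.
Qed.
End Free.

Section ProjectiveUnit.
Variable P : lmodType H.
Hypothesis pP : projective_module P.

(** [P] is a retract of its free cover and the unit is natural; surjectivity follows in the same
    way. *)
Lemma F_unit_inj : injective (F_unit P).
Proof.
have [s sE] := @pP _ _ (free_cover P) idfun (@free_cover_surj _ P).
move=> x y /(congr1 (U_map I (F_map s))); rewrite !F_unit_nat => /F_unit_free_inj.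
by move=> /(congr1 (free_cover P)); rewrite !sE.
Qed.

Lemma F_unit_surj v : exists m, F_unit P m = v.
Proof.
have [s sE] := @pP _ _ (free_cover P) idfun (@free_cover_surj _ P).
have [l lE] := F_unit_free_surj (U_map I (F_map s) v).
exists (free_cover P l); rewrite -F_unit_nat lE; apply: val_inj => /=.
rewrite (F_map_comp (h := idfun)) ?F_map_id//.
Qed.

Lemma F_unit_inverse : exists g : {linear invar I (F_obj P) -> P}, cancel (F_unit P) g /\ cancel g (F_unit P).
Proof.
have [g gE] := linear_factor_mono (g := idfun) F_unit_inj F_unit_surj.
by exists g; split=> // x; apply: F_unit_inj; rewrite gE.
Qed.

(** By a triangle identity the counit is a left inverse of [F_map (F_unit P)], which is
    bijective. *)
Lemma counit_F_inj : injective (counit_rep I (F_obj P)).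
Proof.
have [g [gK Kg]] := F_unit_inverse.
move=> t u; have E v : v = F_map (F_unit P) (F_map g v).
  by rewrite (F_map_comp (h := idfun)) ?F_map_id.
by rewrite (E t) (E u) !counit_F_unit => ->.
Qed.

Section Retract.
Variables (V : smoothRep k G) (i : repHom V (F_obj P)) (r : repHom (F_obj P) V).
Hypothesis riK : forall v, r (i v) = v.

Lemma U_retract v : U_map I r (U_map I i v) = v.
Proof. by apply: val_inj; exact: riK. Qed.

Lemma retract_U_projective : projective_module (invar I V).
Proof.
have [g [gK Kg]] := F_unit_inverse.
by apply: (@projective_retract _ _ _ (g \o U_map I i) (U_map I r \o F_unit P) pP) => v /=;
  rewrite Kg U_retract.
Qed.

Lemma retract_counit_inj : injective (counit_rep I V).
Proof.
move=> t u tu; have E w : w = F_map (U_map I r) (F_map (U_map I i) w).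
  by rewrite (F_map_comp (h := idfun)) ?F_map_id// => v; exact: U_retract.
rewrite (E t) (E u); congr (F_map _ _); apply: counit_F_inj.
by rewrite !counit_nat tu.
Qed.

Lemma retract_counit_surj v : exists t, counit_rep I V t = v.
Proof.
exists (F_map (U_map I r) (F_map (F_unit P) (i v))).
by rewrite counit_nat counit_F_unit riK.
Qed.
End Retract.
End ProjectiveUnit.

(** Uniqueness of the decomposition makes the first coordinate linear and equivariant. *)
Lemma direct_summand_retract (V W : smoothRep k G) : direct_summand V W ->
  exists (i : repHom V W) (r : repHom W V), forall v, r (i v) = v.
Proof.
move=> [V' [i [j [f fK Kf]]]].
have fE w : i (f w).1 + j (f w).2 = w by exact: Kf.
have f_uniq a b w : i a + j b = w -> (f w).1 = a by move=> <-; rewrite (fK (a, b)).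
have [|r0 r0E] := @exists_linear k W V (fun w => (f w).1).
  move=> a u v; apply: (f_uniq _ (a *: (f u).2 + (f v).2)).
  by rewrite !linearP addrACA -scalerDr !fE.
have r0G g w : r0 (act g w) = act g (r0 w).
  rewrite !r0E; apply: (f_uniq _ (act g (f w).2)).
  by rewrite !hom_act -linearD /= fE.
exists i, (RepHom r0G) => v; rewrite /= r0E; apply: (f_uniq _ 0).
by rewrite linear0 addr0.
Qed.

Lemma I_projective_U (V : smoothRep k G) : I_projective I V -> projective_module (invar I V).
Proof.
by move=> [P [pP /direct_summand_retract[i [r riK]]]]; exact: retract_U_projective riK.
Qed.

Lemma I_projective_counit (V : smoothRep k G) : I_projective I V ->
  injective (counit_rep I V) /\ forall v, exists t, counit_rep I V t = v.
Proof.
move=> [P [pP /direct_summand_retract[i [r riK]]]]; split.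
  exact: retract_counit_inj riK.
exact: retract_counit_surj riK.
Qed.

Lemma repHom_inverse (V W : smoothRep k G) (f : repHom V W) :
  injective f -> (forall w, exists v, f v = w) -> exists g : repHom W V, cancel f g /\ cancel g f.
Proof.
move=> fi fs; have [g gE] := linear_factor_mono (g := idfun) fi fs.
have gG x w : g (act x w) = act x (g w) by apply: fi; rewrite hom_act !gE.
by exists (RepHom gG); split=> // x; apply: fi; rewrite /= gE.
Qed.

(** [P] is replaced by the projective module [invar I V]: the counit identifies [V] with its image
    under [F], so that the zero representation serves as complement. *)
Lemma retract_I_projective (V : smoothRep k G) (P : lmodType H) (i : repHom V (F_obj P))
    (r : repHom (F_obj P) V) :
  projective_module P -> (forall v, r (i v) = v) -> I_projective I V.
Proof.
move=> pP riK; exists (invar I V); split; first exact: retract_U_projective riK.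
have [g [gK Kg]] := repHom_inverse (retract_counit_inj pP riK) (retract_counit_surj riK).
exists (zero_rep k G), g, (zero_hom _ _).
exists (fun t => (counit_rep I V t, 0)) => [[v z]|t] /=; last by rewrite addr0 gK.
by rewrite addr0 Kg; congr (_, _); exact: (esym (@thinmx0 k 1 z)).
Qed.
End Unit.

(** * Complexes of representations *)

Section RepComplexes.
Variables (k : fieldType) (G : topGroupType) (p : nat) (I : openProP G p).
Local Notation H := (hecke k I).
Implicit Types (U V W : chRep k G) (C D : chMod H).

Lemma F_chmap_d C D (f : chModHom C D) n x :
  F_map (f n) (cr_d (F_ch C) n x) = cr_d (F_ch D) n (F_map (f (n + 1)) x).
Proof.
rewrite /= (F_map_comp (h := f n \o cm_d C n))// [RHS](F_map_comp (h := f n \o cm_d C n))// => y.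
by rewrite /= cm_homd.
Qed.
Definition F_chmap C D (f : chModHom C D) : chRepHom (F_ch C) (F_ch D) :=
  @ChRepHom k G (F_ch C) (F_ch D) (fun n => F_map (f n)) (@F_chmap_d C D f).

Lemma rep_comp_act (A B C : smoothRep k G) (g : repHom B C) (f : repHom A B) x v :
  (g \o f) (act x v) = act x ((g \o f) v).
Proof. by rewrite /= !hom_act. Qed.
Definition rep_comp (A B C : smoothRep k G) (g : repHom B C) (f : repHom A B) : repHom A C :=
  RepHom (rep_comp_act g f).

Lemma chr_comp_d U V W (g : chRepHom V W) (f : chRepHom U V) n x :
  rep_comp (g n) (f n) (cr_d U n x) = cr_d W n (rep_comp (g (n + 1)) (f (n + 1)) x).
Proof. by rewrite /= !cr_homd. Qed.
Definition chr_comp U V W (g : chRepHom V W) (f : chRepHom U V) : chRepHom U W :=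
  ChRepHom (chr_comp_d g f).

Lemma I_projective_counit_inverse V : (forall n, I_projective I (V n)) ->
  exists e : chRepHom V (F_ch (U_ch I V)), forall n,
    cancel (counit I V n) (e n) /\ cancel (e n) (counit I V n).
Proof.
move=> pV; have [n|e eK] := @dependent_choice int (fun n => repHom (V n) (F_ch (U_ch I V) n))
    (fun n e => cancel (counit I V n) e /\ cancel e (counit I V n)).
  by have [inj surj] := I_projective_counit (pV n); exact: repHom_inverse.
have ed n x : e n (cr_d V n x) = cr_d (F_ch (U_ch I V)) n (e (n + 1) x).
  by rewrite -[x in LHS](eK (n + 1)).2 -cr_homd (eK n).1.
by exists (ChRepHom ed).
Qed.

(** The map [U v] lifts along [U q] in complexes of [H]-modules; the lift is transposed back through
    the counit of [W] and the identification of [V] with [F (U V)]. *)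
Lemma I_exact_cofibrant V : I_exact I V -> (forall n, I_projective I (V n)) -> I_cofibrant I V.
Proof.
move=> aV pV W W' q fq wq u v _.
have [e eK] := I_projective_counit_inverse pV.
have pUV : termwise_projective (U_ch I V) by move=> n; exact: I_projective_U.
have [g gE] := sing_weq_epi_lift (U_chmap I v) pUV aV fq wq.
exists (chr_comp (counit I W) (chr_comp (F_chmap g) e)); split=> n x.
  have -> : x = 0 by exact: (@thinmx0 k 1).
  by rewrite !linear0.
change (q n (counit_rep I (W n) (F_map (g n) (e n x))) = v n x).
rewrite -counit_nat (F_map_comp (h := U_map I (v n))); last by move=> y; exact: gE.
by rewrite counit_nat; congr (v n _); exact: (eK n).2.
Qed.

(** On projectives the unit is bijective, so it identifies [U (F f)] with [f]. *)
Lemma F_trivial_fibration C D (f : chModHom C D) : termwise_projective C -> termwise_projective D ->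
  ch_epi f -> epi_trivial_ker f -> I_fibration I (F_chmap f) /\ I_weq I (F_chmap f).
Proof.
move=> pC pD ef [K [i [[mi _ iq] tK]]].
have unit_d (E : chMod H) n x : F_unit (E n) (cm_d E n x) = cm_d (U_ch I (F_ch E)) n (F_unit (E (n + 1)) x).
  by rewrite -F_unit_nat.
pose unit_ch (E : chMod H) : chModHom E (U_ch I (F_ch E)) :=
  @ChModHom H E (U_ch I (F_ch E)) (fun n => F_unit (E n)) (@unit_d E).
have eF : ch_epi (U_chmap I (F_chmap f)).
  move=> n y; have [d <-] := F_unit_surj (pD n) y; have [c <-] := ef n d.
  by exists (F_unit (C n) c); rewrite [LHS]F_unit_nat.
split=> //; apply: epi_trivial_ker_weq; exists K, (chm_comp (unit_ch C) i); split=> //.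
split=> // [n x y /(F_unit_inj (pC n))/mi //|n y].
have [c <-] := F_unit_surj (pC n) y; rewrite [U_chmap _ _ _ _]F_unit_nat.
split=> [|[x /(F_unit_inj (pC n)) <-]]; last by rewrite (_ : f n _ = 0) ?linear0//; apply/iq; exists x.
rewrite -(linear0 (F_unit (D n))) => /(F_unit_inj (pD n)) /iq[x <-].
by exists x.
Qed.

(** A cycle that is no boundary is detected by some [Phi] into the dual; lifting the resulting map
    through the path fibration forces [Phi x = 0]. *)
Lemma I_cofibrant_acyclic V : I_cofibrant I V -> (forall n, I_projective I (V n)) ->
  acyclic (U_ch I V).
Proof.
move=> cV pV n x dx; apply: contrapT => nx.
have pUV : termwise_projective (U_ch I V) by move=> m; exact: I_projective_U.
have [Phi [dPhi Phix]] := dual_separates (hecke_scalar I : {rmorphism k -> H}) nx.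
have [C [D [q [pC pD eq tq /(_ _ _ pUV dPhi) [f fP]]]]] :=
  test_fibration n (@dual_injective k H (hecke_scalar I)).
have [e eK] := I_projective_counit_inverse pV.
have [fibq wq] := F_trivial_fibration pC pD eq tq.
have [m y|h [_ hE]] := cV _ _ _ fibq wq (from_zero (F_ch C)) (chr_comp (F_chmap f) e).
  have -> : y = 0 by exact: (@thinmx0 k 1).
  by rewrite !linear0.
(* The image of [x] under the lift comes from an element [c] of [C], a cycle over [f x] because the
   unit is natural and injective. *)
have [c cE] := F_unit_surj (pC _) (U_map I (h (n + 1)) x).
have e_unit m (y : U_ch I V m) : e m (invar_val y) = invar_val (F_unit _ y).
  by rewrite -[RHS](eK m).1; congr (e m _); rewrite -[in LHS](U_counit_unit y).
apply: Phix; apply: (fP x c).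
  apply: (F_unit_inj (pC _)); rewrite -F_unit_nat cE linear0; apply: val_inj => /=.
  by rewrite -(cr_homd h) (_ : cr_d V n _ = 0) ?linear0//; exact: (congr1 val dx).
apply: (F_unit_inj (pD _)); rewrite -!F_unit_nat cE; apply: val_inj => /=.
by rewrite [LHS]hE /= e_unit.
Qed.
End RepComplexes.

(** * Disk complexes of representations *)

Section ProductRep.
Variables (k : fieldType) (G : topGroupType) (V W : smoothRep k G).

Definition prod_act_fun (g : G) (x : V * W) : V * W := (act g x.1, act g x.2).

Lemma prod_act_linear g : linear (prod_act_fun g).
Proof. by move=> a x y; congr (_, _); rewrite linearP. Qed.

Definition prod_act g : {linear (V * W)%type -> (V * W)%type} :=
  HB.pack (prod_act_fun g) (GRing.isLinear.Build k _ _ _ _ (prod_act_linear g)).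

Lemma prod_act1 x : prod_act 1%g x = x.
Proof. by case: x => v w; congr (_, _); exact: act1. Qed.

Lemma prod_actM g h x : prod_act (g * h)%g x = prod_act g (prod_act h x).
Proof. by congr (_, _); exact: actM. Qed.

Lemma prod_act_smooth x : open [set g | prod_act g x = x]%classic.
Proof.
have -> : ([set g | prod_act g x = x] = [set g | act g x.1 = x.1] `&` [set g | act g x.2 = x.2])%classic.
  apply/seteqP; split=> g /=; first by case: x => v w [] /= -> ->.
  by case: x => v w /= [gv gw]; congr (_, _).
by apply: openI; exact: act_smooth.
Qed.

Definition prodRep : smoothRep k G :=
  @SmoothRep k G (V * W)%type prod_act prod_act1 prod_actM prod_act_smooth.

Lemma inl_linear : linear (fun v : V => (v, 0) : V * W).
Proof. by move=> a x y; congr (_, _); rewrite /= scaler0 addr0. Qed.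
Definition inl_lin : {linear V -> prodRep} :=
  HB.pack (fun v : V => (v, 0) : prodRep) (GRing.isLinear.Build k _ _ _ _ inl_linear).
Lemma inl_act g v : inl_lin (act g v) = act g (inl_lin v).
Proof. by congr (_, _); rewrite /= linear0. Qed.
Definition inl_rep : repHom V prodRep := RepHom inl_act.

Lemma inr_linear : linear (fun w : W => (0, w) : V * W).
Proof. by move=> a x y; congr (_, _); rewrite /= scaler0 addr0. Qed.
Definition inr_lin : {linear W -> prodRep} :=
  HB.pack (fun w : W => (0, w) : prodRep) (GRing.isLinear.Build k _ _ _ _ inr_linear).
Lemma inr_act g w : inr_lin (act g w) = act g (inr_lin w).
Proof. by congr (_, _); rewrite /= linear0. Qed.
Definition inr_rep : repHom W prodRep := RepHom inr_act.

Definition fst_rep : repHom prodRep V :=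
  @RepHom k G prodRep V (fst : {linear (V * W)%type -> V}) (fun _ _ => erefl).
Definition snd_rep : repHom prodRep W :=
  @RepHom k G prodRep W (snd : {linear (V * W)%type -> W}) (fun _ _ => erefl).
End ProductRep.

Section DiskRep.
Variables (k : fieldType) (G : topGroupType).
Implicit Type A B : int -> smoothRep k G.

Lemma transport_rep_linear A a b (e : a = b) : linear (transport (S := A) e).
Proof. by case: b / e. Qed.

Lemma transport_rep_act A a b (e : a = b) g (x : A a) :
  transport (S := A) e (act g x) = act g (transport (S := A) e x).
Proof. by case: b / e. Qed.

Lemma transport_rep0 A a b (e : a = b) : transport (S := A) e 0 = 0.
Proof. by case: b / e. Qed.

Section Disk.
Variable A : int -> smoothRep k G.
Local Notation D n := (prodRep (A n) (A (n - 1))).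

Definition disk_rep_fun n (x : D (n + 1)) : D n := (transport (S := A) (addrK 1 n) x.2, 0).

Lemma disk_rep_fun_linear n : linear (@disk_rep_fun n).
Proof.
by move=> a x y; congr (_, _); [exact: transport_rep_linear|rewrite /= scaler0 addr0].
Qed.

Definition disk_rep_lin n : {linear D (n + 1) -> D n} :=
  HB.pack (@disk_rep_fun n) (GRing.isLinear.Build k _ _ _ _ (@disk_rep_fun_linear n)).

Lemma disk_rep_act n g x : disk_rep_lin n (act g x) = act g (disk_rep_lin n x).
Proof. by congr (_, _); [exact: transport_rep_act|rewrite /= linear0]. Qed.

Definition disk_rep_d n : repHom (D (n + 1)) (D n) := RepHom (@disk_rep_act n).

Lemma disk_rep_dd n x : disk_rep_d n (disk_rep_d (n + 1) x) = 0.
Proof. by congr (_, _); exact: transport_rep0. Qed.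

Definition disk_rep : chRep k G := @ChRep k G (fun n => D n) disk_rep_d disk_rep_dd.
End Disk.

Section DiskMap.
Variables (A B : int -> smoothRep k G) (q : forall n, repHom (A n) (B n)).

Lemma disk_map_linear n : linear (fun x : A n * A (n - 1)%R => (q n x.1, q (n - 1) x.2)).
Proof. by move=> a x y; congr (_, _); rewrite linearP. Qed.
Definition disk_map_lin n : {linear disk_rep A n -> disk_rep B n} :=
  HB.pack (fun x : disk_rep A n => (q n x.1, q (n - 1) x.2) : disk_rep B n)
    (GRing.isLinear.Build k _ _ _ _ (@disk_map_linear n)).
Lemma disk_map_act n g x : disk_map_lin n (act g x) = act g (disk_map_lin n x).
Proof. by congr (_, _); exact: hom_act. Qed.
Definition disk_map_rep n : repHom (disk_rep A n) (disk_rep B n) := RepHom (@disk_map_act n).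

Lemma disk_map_d n x :
  disk_map_rep n (cr_d (disk_rep A) n x) = cr_d (disk_rep B) n (disk_map_rep (n + 1) x).
Proof.
congr (_, _); rewrite /= ?linear0//.
exact: (transport_nat (S := A) (S' := B) (fun m => q m)).
Qed.
Definition disk_map : chRepHom (disk_rep A) (disk_rep B) := ChRepHom disk_map_d.
End DiskMap.

Section ToDisk.
Variable V : chRep k G.

Definition rep_prev n (v : V n) : V (n - 1) :=
  shifted_d (S := cr_obj V) (fun n => cr_d V n) v.

Lemma to_disk_linear n : linear (fun v : V n => (v, rep_prev v) : disk_rep V n).
Proof. by move=> a x y; congr (_, _); rewrite /rep_prev /shifted_d transport_rep_linear linearP. Qed.
Definition to_disk_lin n : {linear V n -> disk_rep V n} :=
  HB.pack (fun v : V n => (v, rep_prev v) : disk_rep V n)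
    (GRing.isLinear.Build k _ _ _ _ (@to_disk_linear n)).
Lemma to_disk_act n g v : to_disk_lin n (act g v) = act g (to_disk_lin n v).
Proof. by congr (_, _); rewrite /rep_prev /shifted_d transport_rep_act hom_act. Qed.
Definition to_disk_rep n : repHom (V n) (disk_rep V n) := RepHom (@to_disk_act n).

Lemma to_disk_d n v :
  to_disk_rep n (cr_d V n v) = cr_d (disk_rep V) n (to_disk_rep (n + 1) v).
Proof.
congr (_, _); first by rewrite [RHS]transport_shifted_d.
exact: (shifted_d_d (z := fun=> 0) (@cr_dd _ _ V)).
Qed.
(** The chain map into the disk that corresponds to the family of identities of the [V n]. *)
Definition to_disk : chRepHom V (disk_rep V) := ChRepHom to_disk_d.
End ToDisk.
End DiskRep.

(** * Cofibrant complexes are termwise I-projective *)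

Section CofibrantTermwise.
Variables (k : fieldType) (G : topGroupType) (p : nat) (I : openProP G p).
Local Notation H := (hecke k I).

(** Invariants commute with products, so the kernel after [U] is the disk on the kernels of the
    [U (q n)], which is trivial by [disk_sing_trivial]. *)
Lemma disk_map_trivial_fibration (A B : int -> smoothRep k G) (q : forall n, repHom (A n) (B n)) :
  (forall n y, exists x, U_map I (q n) x = y) ->
  I_fibration I (disk_map q) /\ I_weq I (disk_map q).
Proof.
move=> Uq.
have eq : ch_epi (U_chmap I (disk_map q)).
  move=> n y.
  have [a aE] := Uq n (U_map I (fst_rep _ _) y).
  have [b bE] := Uq (n - 1) (U_map I (snd_rep _ _) y).
  exists (U_map I (inl_rep _ _) a + U_map I (inr_rep _ _) b); apply: val_inj => /=.
  rewrite [RHS]surjective_pairing; congr (_, _).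
    by rewrite /= addr0; exact: (congr1 val aE).
  by rewrite /= add0r; exact: (congr1 val bE).
split=> //; apply: epi_trivial_ker_weq.
pose L n : lmodType H := kernel (U_map I (q n)).
pose j n : {linear disk_ch L n -> U_ch I (disk_rep A) n} :=
  (U_map I (inl_rep (A n) (A (n - 1))) \o @kernel_val _ _ _ (U_map I (q n)) \o fst) \+
  (U_map I (inr_rep (A n) (A (n - 1))) \o @kernel_val _ _ _ (U_map I (q (n - 1))) \o snd).
have jE n x : invar_val (j n x) = (invar_val (kernel_val x.1), invar_val (kernel_val x.2)).
  by congr (_, _); rewrite /= ?addr0 ?add0r.
have jd n x : j n (cm_d (disk_ch L) n x) = cm_d (U_ch I (disk_rep A)) n (j (n + 1) x).
  apply: val_inj; rewrite [LHS]jE; congr (_, _) => /=.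
  rewrite add0r.
  exact: (transport_nat (S := L) (S' := A) (fun m l => invar_val (kernel_val l))).
exists (disk_ch L), (@ChModHom H (disk_ch L) (U_ch I (disk_rep A)) j jd); split; last first.
  exact: disk_sing_trivial.
split=> // [n x y /(congr1 val)|n y].
  rewrite [LHS]jE [RHS]jE => -[x1 x2]; rewrite [x]surjective_pairing [y]surjective_pairing.
  by congr (_, _); do 2! apply: val_inj.
split=> [qy|[x <-]]; last first.
  apply: val_inj; congr (_, _).
    by rewrite /= addr0; exact: (congr1 val (kernelP x.1)).
  by rewrite /= add0r; exact: (congr1 val (kernelP x.2)).
have [a aE] : exists a : L n, kernel_val a = U_map I (fst_rep _ _) y.
  by apply: kernel_ex; apply: val_inj; exact: (congr1 (fun z : U_ch I (disk_rep B) n =>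
    (invar_val z : (B n * B (n - 1)%R)%type).1) qy).
have [b bE] : exists b : L (n - 1), kernel_val b = U_map I (snd_rep _ _) y.
  by apply: kernel_ex; apply: val_inj; exact: (congr1 (fun z : U_ch I (disk_rep B) n =>
    (invar_val z : (B n * B (n - 1)%R)%type).2) qy).
exists (a, b); apply: val_inj; rewrite [LHS]jE /= aE bE.
by rewrite [RHS]surjective_pairing.
Qed.

Lemma I_cofibrant_I_projective (V : chRep k G) n : I_cofibrant I V -> I_projective I (V n).
Proof.
move=> cV.
pose A m := F_obj (freeMod H (invar I (V m))).
pose q m : repHom (A m) (V m) := rep_comp (counit_rep I (V m)) (F_map (free_cover (invar I (V m)))).
have [m y|fq wq] := @disk_map_trivial_fibration A V q.
  (* A preimage of [y] under the free cover gives an invariant through the unit; the triangle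
     identity sends it back to [y]. *)
  have [l <-] := free_cover_surj y; exists (F_unit _ l).
  by rewrite -[RHS]U_counit_unit -F_unit_nat; exact: val_inj.
have [m y|h [_ hE]] := cV _ _ _ fq wq (from_zero (disk_rep A)) (to_disk V).
  have -> : y = 0 by exact: (@thinmx0 k 1).
  by rewrite !linear0.
(* The first component of the lift of [to_disk V] is a section of [q n]. *)
apply: (@retract_I_projective _ _ _ _ _ _ (rep_comp (fst_rep _ _) (h n)) (q n)).
  exact: freeMod_projective.
by move=> v; exact: (congr1 fst (hE n v)).
Qed.

Lemma I_projective_counit_iso (V : chRep k G) : (forall n, I_projective I (V n)) -> ch_iso (counit I V).
Proof. by move=> /I_projective_counit_inverse[e eK]; exists e. Qed.
End CofibrantTermwise.

Theorem lemma4p7 (k : fieldType) (p : nat) (pk : p \in [pchar k])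
    (G : topGroupType) (I : openProP G p) (V : chRep k G) :
  [/\ I_cofibrant I V <-> (I_exact I V /\ forall n, I_projective I (V n)),
      (I_exact I V /\ forall n, I_projective I (V n)) <->
        [/\ forall n, I_projective I (V n), acyclic (U_ch I V) &
            termwise_projective (U_ch I V)] &
      I_cofibrant I V -> ch_iso (counit I V)].
Proof.
split.
- split=> [cV|[aV pV]]; last exact: I_exact_cofibrant.
  have pV n := I_cofibrant_I_projective n cV.
  by split=> //; exact: I_cofibrant_acyclic.
- split=> [[aV pV]|[pV aV _]] //; split=> // n; exact: I_projective_U.
- by move=> cV; apply: I_projective_counit_iso => n; exact: I_cofibrant_I_projective.
Qed.
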